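(* The vector space $\mathscr{A}$ with multiplication $\widetilde{\mu}$, comultiplication $\widetilde{\Delta}$, unit $1$, counit $\varepsilon$, antipode $S$, and the Yetter–Drinfeld structure given by the $\mathbb{Z}$-grading by $\deg$ and the $\mathbb{Z}$-action $k\cdot a=\zeta^{-k\deg(a)}a$ ($k\in\mathbb{Z}$, $a\in\mathscr{A}$ homogeneous), is a Hopf algebra in the braided monoidal category ${}^{\mathbb{Z}}_{\mathbb{Z}}\mathcal{YD}$ of Yetter–Drinfeld modules over the group algebra $\mathbb{C}[\mathbb{Z}]$.
   Context: Fix $q\in\mathbb{C}$ with $0<|q|<1$ and put $\zeta=q/\overline{q}\in\mathbb{T}$. $A$ is the universal unital $C^*$-algebra generated by $\alpha,\gamma$ with $\alpha^*\alpha+\gamma^*\gamma=1$, $\alpha\alpha^*+|q|^2\gamma^*\gamma=1$, $\alpha\gamma=\overline{q}\gamma\alpha$, $\gamma\gamma^*=\gamma^*\gamma$ (these imply $\alpha\gamma^*=q\gamma^*\alpha$). $\mathscr{A}\subseteq A$ is the unital $*$-subalgebra generated algebraically by $\alpha,\gamma$. Let $\boldsymbol{z}\in C(\mathbb{T})$ be the identity function. $\mathbb{T}$ acts on $A$ via $\rho^A\colon A\to C(\mathbb{T})\otimes A$, $\rho^A(\alpha)=1\otimes\alpha$, $\rho^A(\gamma)=\boldsymbol{z}\otimes\gamma$; $x$ is homogeneous of degree $\deg(x)=n\in\mathbb{Z}$ if $\rho^A(x)=\boldsymbol{z}^n\otimes x$. This gives a $\mathbb{Z}$-grading of $\mathscr{A}$.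 Let $C(\mathbb{T}^2_\zeta)$ be the universal $C^*$-algebra generated by unitaries $U,V$ with $UV=\zeta VU$. The braided tensor product $A\boxtimes A$ is the closed linear span of $\{\iota_1(x)\iota_2(y)\}$ in $C(\mathbb{T}^2_\zeta)\otimes A\otimes A$, where $\iota_1,\iota_2$ are the unital $*$-homomorphisms with $\iota_1(x)=U^{\deg(x)}\otimes x\otimes 1$, $\iota_2(y)=V^{\deg(y)}\otimes 1\otimes y$ for homogeneous $x,y$. The comultiplication is the unital $*$-homomorphism $\Delta_A\colon A\to A\boxtimes A$ with $\Delta_A(\alpha)=\iota_1(\alpha)\iota_2(\alpha)-q\iota_1(\gamma^* )\iota_2(\gamma)$, $\Delta_A(\gamma)=\iota_1(\gamma)\iota_2(\alpha)+\iota_1(\alpha^* )\iota_2(\gamma)$. $\mathscr{A}\boxtimes_{\rm alg}\mathscr{A}\subseteq A\boxtimes A$ is the linear span of $\{\iota_1(a)\iota_2(b): a,b\in\mathscr{A}\}$; it contains $\Delta_A(\mathscr{A})$, and $\phi_{\otimes,\boxtimes}\colon\mathscr{A}\otimes_{\rm alg}\mathscr{A}\to\mathscr{A}\boxtimes_{\rm alg}\mathscr{A}$, $a\otimes b\mapsto\iota_1(a)\iota_2(b)$, is a linear isomorphism. The structure maps are: $\widetilde{\mu}(a\otimes b)=ab$; $\widetilde{\Delta}=\phi_{\otimes,\boxtimes}^{-1}\circ\Delta_A|_{\mathscr{A}}\colon\mathscr{A}\to\mathscr{A}\otimes_{\rm alg}\mathscr{A}$; $\varepsilon\colon\mathscr{A}\to\mathbb{C}$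 is the restriction of the character of $A$ with $\varepsilon(\alpha)=1$, $\varepsilon(\gamma)=0$; $S\colon\mathscr{A}\to\mathscr{A}$ is the unique unital, linear, degree-preserving map with $S(\alpha)=\alpha^*$, $S(\alpha^* )=\alpha$, $S(\gamma)=-\overline{q}\gamma$, $S(\gamma^* )=-\tfrac1q\gamma^*$ and $S(ab)=\zeta^{-\deg(a)\deg(b)}S(b)S(a)$ for homogeneous $a,b$. Objects of ${}^{\mathbb{Z}}_{\mathbb{Z}}\mathcal{YD}$ are $\mathbb{Z}$-graded vector spaces with a grading-preserving linear action of $\mathbb{Z}$; morphisms are graded $\mathbb{Z}$-equivariant linear maps; the tensor product is the algebraic one with the diagonal grading and action; the braiding is $c_{V,W}(v\otimes w)=(k\cdot w)\otimes v$ for $v\in V$ homogeneous of degree $k$. A Hopf algebra in this category is an object with structure maps (multiplication, unit, comultiplication, counit, antipode) that are all morphisms, such that the algebra and coalgebra axioms hold, the comultiplication and counit are algebra maps (where $H\otimes H$ has multiplication $(\widetilde\mu\otimes\widetilde\mu)\circ(\mathrm{id}\otimes c_{H,H}\otimes\mathrm{id})$), and the antipode is the convolution inverse of the identity. *)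

(* Defs.v *)
From HB Require Import structures.
From mathcomp Require Import all_boot all_order all_algebra.
From mathcomp Require Import boolp classical_sets reals.
From mathcomp Require Import complex.

Set Implicit Arguments.
Unset Strict Implicit.
Unset Printing Implicit Defensive.

Import Order.TTheory GRing.Theory Num.Theory.
Local Open Scope ring_scope.
Local Open Scope quotient_scope.
Local Open Scope classical_set_scope.

Section BilinearPack.
Variables (K : fieldType) (V W U : lmodType K) (f : V -> W -> U).
Hypothesis Hf : bilinear_for *:%R *:%R f.
Definition mkbilinear : {bilinear V -> W -> U} :=
  HB.pack_for {bilinear V -> W -> U} f (bilinear_isBilinear.Build K V W U _ _ f Hf).
Lemma mkbilinearE v w : mkbilinear v w = f v w. Proof. by []. Qed.
End BilinearPack.

(* The algebraic tensor product: a formal sum of pure tensors is a list of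
   pairs, and two formal sums are identified when every bilinear map takes the
   same value on both. *)
Section TensorProduct.
Variables (K : fieldType) (V W : lmodType K).
Implicit Types (s t : seq (V * W)).

Definition fsum (U : lmodType K) (f : V -> W -> U) s : U :=
  \sum_(p <- s) f p.1 p.2.

Definition tens_eqv s t : bool :=
  `[< forall (U : lmodType K) (f : {bilinear V -> W -> U}),
        fsum f s = fsum f t >].

Lemma tens_eqvP s t :
  reflect (forall (U : lmodType K) (f : {bilinear V -> W -> U}),
             fsum f s = fsum f t) (tens_eqv s t).
Proof. exact: asboolP. Qed.

Lemma tens_eqv_refl : reflexive tens_eqv.
Proof. by move=> s; apply/tens_eqvP. Qed.
Lemma tens_eqv_sym : symmetric tens_eqv.
Proof. by move=> s t; apply/tens_eqvP/tens_eqvP => H U f; rewrite H. Qed.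
Lemma tens_eqv_trans : transitive tens_eqv.
Proof.
by move=> t s r /tens_eqvP H1 /tens_eqvP H2; apply/tens_eqvP => U f; rewrite H1.
Qed.
Canonical tens_equiv := EquivRel tens_eqv tens_eqv_refl tens_eqv_sym tens_eqv_trans.

Definition tens := {eq_quot tens_equiv}.
HB.instance Definition _ := Choice.on tens.

Definition tclass s : tens := \pi_tens s.
Lemma tclassP s t :
  tclass s = tclass t <->
  forall (U : lmodType K) (f : {bilinear V -> W -> U}), fsum f s = fsum f t.
Proof.
by split=> [/eqP|H]; [rewrite /tclass eqmodE => /tens_eqvP |
  apply/eqP; rewrite /tclass eqmodE; apply/tens_eqvP].
Qed.
Lemma tclass_repr (x : tens) : tclass (repr x) = x.
Proof. exact: reprK. Qed.

Definition tzero : tens := tclass [::].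
Definition tadd (x y : tens) : tens := tclass (repr x ++ repr y).
Definition tscale (a : K) (x : tens) : tens :=
  tclass [seq (a *: p.1, p.2) | p <- repr x].
Definition topp (x : tens) : tens := tscale (-1) x.

Lemma fsum_repr (U : lmodType K) (f : {bilinear V -> W -> U}) s :
  fsum f (repr (tclass s)) = fsum f s.
Proof. by move: (tclass_repr (tclass s)) => /tclassP; apply. Qed.
Lemma fsum_cat (U : lmodType K) (f : V -> W -> U) s t :
  fsum f (s ++ t) = fsum f s + fsum f t.
Proof. by rewrite /fsum big_cat. Qed.
Lemma fsum_scale (U : lmodType K) (f : {bilinear V -> W -> U}) a s :
  fsum f [seq (a *: p.1, p.2) | p <- s] = a *: fsum f s.
Proof.
by rewrite /fsum big_map scaler_sumr; apply: eq_bigr => p _ /=; rewrite linearZl.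
Qed.
Lemma fsum_nil (U : lmodType K) (f : V -> W -> U) : fsum f [::] = 0.
Proof. by rewrite /fsum big_nil. Qed.

Lemma taddA : associative tadd.
Proof.
by move=> x y z; apply/tclassP => U f; rewrite !(fsum_cat, fsum_repr) addrA.
Qed.
Lemma taddC : commutative tadd.
Proof. by move=> x y; apply/tclassP => U f; rewrite !fsum_cat addrC. Qed.
Lemma tadd0 : left_id tzero tadd.
Proof.
move=> x; rewrite -[RHS]tclass_repr; apply/tclassP => U f.
by rewrite !(fsum_cat, fsum_repr) fsum_nil add0r.
Qed.
Lemma taddN : left_inverse tzero topp tadd.
Proof.
move=> x; apply/tclassP => U f.
by rewrite !(fsum_cat, fsum_repr, fsum_scale) fsum_nil scaleN1r addNr.
Qed.
HB.instance Definition _ := GRing.isZmodule.Build tens taddA taddC tadd0 taddN.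

Lemma tscaleA a b x : tscale a (tscale b x) = tscale (a * b) x.
Proof.
by apply/tclassP => U f; rewrite !(fsum_scale, fsum_repr) scalerA.
Qed.
Lemma tscale1 : left_id 1 tscale.
Proof.
move=> x; rewrite -[RHS]tclass_repr; apply/tclassP => U f.
by rewrite fsum_scale scale1r.
Qed.
Lemma tscaleDr : right_distributive tscale +%R.
Proof.
move=> a x y; apply/tclassP => U f.
by rewrite !(fsum_scale, fsum_repr, fsum_cat) scalerDr.
Qed.
Lemma tscaleDl x : {morph tscale^~ x : a b / a + b}.
Proof.
move=> a b; apply/tclassP => U f.
by rewrite !(fsum_scale, fsum_repr, fsum_cat) scalerDl.
Qed.
HB.instance Definition _ := GRing.Zmodule_isLmodule.Build K tens
  tscaleA tscale1 tscaleDr tscaleDl.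

Definition tmk (v : V) (w : W) : tens := tclass [:: (v, w)].

Section Lift.
Variables (U : lmodType K) (f : {bilinear V -> W -> U}).
Definition tlift (x : tens) : U := fsum f (repr x).
Lemma tlift_is_linear : linear tlift.
Proof.
by move=> a x y; rewrite /tlift !(fsum_repr, fsum_cat, fsum_scale).
Qed.
HB.instance Definition _ :=
  GRing.isLinear.Build K tens U *:%R tlift tlift_is_linear.
Lemma tliftE v w : tlift (tmk v w) = f v w.
Proof. by rewrite /tlift fsum_repr /fsum big_seq1. Qed.
End Lift.

Lemma tmk_is_bilinear : bilinear_for *:%R *:%R tmk.
Proof.
split=> u a x y; apply/tclassP => U f;
  rewrite !(fsum_repr, fsum_cat, fsum_scale) /fsum !big_seq1 /=.
  by rewrite linearPl.
by rewrite linearPr.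
Qed.
HB.instance Definition _ :=
  bilinear_isBilinear.Build K V W tens _ _ tmk tmk_is_bilinear.

Lemma tens_sum (x : tens) : exists s, x = \sum_(p <- s) tmk p.1 p.2.
Proof.
exists (repr x); rewrite -[LHS]tclass_repr.
elim: (repr x) => [|p s IH]; first by rewrite big_nil.
rewrite big_cons -IH; apply/tclassP => U f.
by rewrite !(fsum_cat, fsum_repr) /fsum big_cons big_seq1.
Qed.

Lemma tens_ext (U : lmodType K) (g h : {linear tens -> U}) :
  (forall v w, g (tmk v w) = h (tmk v w)) -> g =1 h.
Proof.
move=> H x; have [s ->] := tens_sum x; rewrite !linear_sum.
by apply: eq_bigr => p _; apply: H.
Qed.
End TensorProduct.

Notation "v \otimes w" := (tmk v w) (at level 40, left associativity) : ring_scope.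

Section TensorMaps.
Variable K : fieldType.
Implicit Types U V W X : lmodType K.

Section Map.
Variables (V W V' W' : lmodType K).
Variables (f : {linear V -> V'}) (g : {linear W -> W'}).
Definition tmap_fun (v : V) (w : W) := f v \otimes g w.
Lemma tmap_bilinear : bilinear_for *:%R *:%R tmap_fun.
Proof.
split=> u a x y; rewrite /tmap_fun /=; first by rewrite linearD linearZ /= linearPl.
by rewrite linearD linearZ /= linearPr.
Qed.
Definition tmap : {linear tens V W -> tens V' W'} := tlift (mkbilinear tmap_bilinear).
Lemma tmapE v w : tmap (v \otimes w) = f v \otimes g w.
Proof. exact: tliftE. Qed.
End Map.

Section Assoc.
Variables (U V W : lmodType K).

Section Fix1.
Variable w : W.
Definition assoc1_fun (u : U) (v : V) := u \otimes (v \otimes w).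
Lemma assoc1_bilinear : bilinear_for *:%R *:%R assoc1_fun.
Proof.
split=> x a y z; rewrite /assoc1_fun; first by rewrite linearPl.
by rewrite linearPl linearPr.
Qed.
Definition assoc1 : {linear tens U V -> tens U (tens V W)} := tlift (mkbilinear assoc1_bilinear).
End Fix1.
Lemma assoc1_sum w (s : seq (U * V)) :
  assoc1 w (\sum_(p <- s) p.1 \otimes p.2) = \sum_(p <- s) p.1 \otimes (p.2 \otimes w).
Proof. by rewrite linear_sum; apply: eq_bigr => p _; exact: tliftE. Qed.
Lemma assoc_bilinear : bilinear_for *:%R *:%R (fun t w => assoc1 w t).
Proof.
split=> [w a x y|t a x y]; first by rewrite linearP.
have [s ->] := tens_sum t; rewrite /= !assoc1_sum scaler_sumr -big_split /=.
by apply: eq_bigr => p _; rewrite !linearPr.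
Qed.
Definition tassoc : {linear tens (tens U V) W -> tens U (tens V W)} :=
  tlift (mkbilinear assoc_bilinear).
Lemma tassocE u v w : tassoc (u \otimes v \otimes w) = u \otimes (v \otimes w).
Proof. by transitivity (assoc1 w (u \otimes v)); exact: tliftE. Qed.

Section Fix2.
Variable u : U.
Definition unassoc1_fun (v : V) (w : W) := u \otimes v \otimes w.
Lemma unassoc1_bilinear : bilinear_for *:%R *:%R unassoc1_fun.
Proof.
split=> x a y z; rewrite /unassoc1_fun; last by rewrite linearPr.
by rewrite linearPr linearPl.
Qed.
Definition unassoc1 : {linear tens V W -> tens (tens U V) W} := tlift (mkbilinear unassoc1_bilinear).
End Fix2.
Lemma unassoc1_sum u (s : seq (V * W)) :
  unassoc1 u (\sum_(p <- s) p.1 \otimes p.2) = \sum_(p <- s) u \otimes p.1 \otimes p.2.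
Proof. by rewrite linear_sum; apply: eq_bigr => p _; exact: tliftE. Qed.
Lemma unassoc_bilinear : bilinear_for *:%R *:%R (fun u t => unassoc1 u t).
Proof.
split=> [t a x y|u a x y]; last by rewrite linearP.
have [s ->] := tens_sum t; rewrite /= !unassoc1_sum scaler_sumr -big_split /=.
by apply: eq_bigr => p _; rewrite !linearPl.
Qed.
Definition tunassoc : {linear tens U (tens V W) -> tens (tens U V) W} :=
  tlift (mkbilinear unassoc_bilinear).
Lemma tunassocE u v w : tunassoc (u \otimes (v \otimes w)) = u \otimes v \otimes w.
Proof. by transitivity (unassoc1 u (v \otimes w)); exact: tliftE. Qed.
End Assoc.

Section Units.
Variable V : lmodType K.
Lemma lunit_bilinear : bilinear_for *:%R *:%R (fun (a : K^o) (v : V) => a *: v).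
Proof.
split=> u a x y; first by rewrite /= scalerDl scalerA.
by rewrite /= scalerDr !scalerA mulrC.
Qed.
Definition tlunit : {linear tens K^o V -> V} := tlift (mkbilinear lunit_bilinear).
Lemma tlunitE (a : K^o) v : tlunit (a \otimes v) = a *: v.
Proof. exact: tliftE. Qed.
Lemma runit_bilinear : bilinear_for *:%R *:%R (fun (v : V) (a : K^o) => a *: v).
Proof.
split=> u a x y; last by rewrite /= scalerDl scalerA.
by rewrite /= scalerDr !scalerA mulrC.
Qed.
Definition trunit : {linear tens V K^o -> V} := tlift (mkbilinear runit_bilinear).
Lemma trunitE (a : K^o) v : trunit (v \otimes a) = a *: v.
Proof. exact: tliftE. Qed.

Variable u : V.
Definition unit_map (a : K^o) : V := a *: u.
Lemma unit_map_linear : linear unit_map.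
Proof. by move=> a x y; rewrite /unit_map scalerDl scalerA. Qed.
HB.instance Definition _ :=
  GRing.isLinear.Build K K^o V *:%R unit_map unit_map_linear.
End Units.

Section Mul.
Variable A : algType K.
Lemma mul_bilinear : bilinear_for *:%R *:%R (fun x y : A => x * y).
Proof.
split=> u a x y; first by rewrite /= mulrDl scalerAl.
by rewrite /= mulrDr scalerAr.
Qed.
Definition mul_map : {linear tens A A -> A} := tlift (mkbilinear mul_bilinear).
Lemma mul_mapE x y : mul_map (x \otimes y) = x * y.
Proof. exact: tliftE. Qed.
End Mul.
End TensorMaps.

Section Gradings.
Variables (K : fieldType) (V : lmodType K).

(* V is the direct sum of the subspaces comp n. *)
Record is_grading (comp : int -> set V) : Prop := IsGrading {
  grading0 : forall n, comp n 0;
  gradingP : forall n a u v, comp n u -> comp n v -> comp n (a *: u + v);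
  grading_span : forall v, exists (s : seq int) (f : int -> V),
    [/\ uniq s, forall n, comp n (f n) & v = \sum_(n <- s) f n];
  grading_indep : forall (s : seq int) (f : int -> V),
    uniq s -> (forall n, comp n (f n)) -> \sum_(n <- s) f n = 0 ->
    forall n, n \in s -> f n = 0 }.

Record is_yd (comp : int -> set V) (act : int -> {linear V -> V}) : Prop := IsYD {
  yd_grading : is_grading comp;
  yd_act0 : act 0 =1 id;
  yd_actD : forall k l v, act (k + l) v = act k (act l v);
  yd_act_comp : forall k n v, comp n v -> comp n (act k v) }.
End Gradings.

Record ydModule (K : fieldType) : Type := YDModule {
  yd_car :> lmodType K;
  yd_comp : int -> set yd_car;
  yd_act : int -> {linear yd_car -> yd_car};
  yd_ax : is_yd yd_comp yd_act }.
Arguments yd_comp {K} V n _ : rename.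
Arguments yd_act {K} V k : rename.
Arguments yd_ax {K} V : rename.

Section HomogeneousParts.
Variables (K : fieldType) (V : ydModule K).

Local Notation comp := (@yd_comp K V).
Let gr : is_grading comp := yd_grading (yd_ax V).

Lemma decomp_ex (v : V) : exists d : seq int * (int -> V),
  [/\ uniq d.1, forall n, comp n (d.2 n), forall n, n \notin d.1 -> d.2 n = 0
    & v = \sum_(n <- d.1) d.2 n].
Proof.
have [s [f [us cf ->]]] := grading_span gr v.
exists (s, fun n => if n \in s then f n else 0); split=> //=.
- by move=> n; case: ifP => _; [apply: cf | apply: grading0].
- by move=> n /negbTE ->.
- by apply: eq_big_seq => n ->.
Qed.

Definition decomp (v : V) : seq int * (int -> V) := sval (cid (decomp_ex v)).
Definition hsupp (v : V) : seq int := (decomp v).1.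
Definition hpart (n : int) (v : V) : V := (decomp v).2 n.

Lemma hsupp_uniq v : uniq (hsupp v).
Proof. by have [] := svalP (cid (decomp_ex v)). Qed.
Lemma hpart_comp n v : comp n (hpart n v).
Proof. by have [_ H _ _] := svalP (cid (decomp_ex v)); apply: H. Qed.
Lemma hpart_out n v : n \notin hsupp v -> hpart n v = 0.
Proof. by have [_ _ H _] := svalP (cid (decomp_ex v)); apply: H. Qed.
Lemma hpart_sum v : v = \sum_(n <- hsupp v) hpart n v.
Proof. by have [_ _ _ H] := svalP (cid (decomp_ex v)); apply: H. Qed.

Lemma big_ext (U : lmodType K) (f : int -> U) (s t : seq int) :
  uniq s -> uniq t -> {subset s <= t} -> (forall n, n \notin s -> f n = 0) ->
  \sum_(n <- t) f n = \sum_(n <- s) f n.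
Proof.
move=> us ut st f0; rewrite (bigID (mem s)) /= [X in _ + X]big1 ?addr0; last first.
  by move=> n; apply: f0.
rewrite -big_filter; apply: perm_big; apply: uniq_perm => //.
  exact: filter_uniq.
move=> n; rewrite mem_filter /= andbC; case: (boolP (n \in s)) => [/st ->//|].
by rewrite andbF.
Qed.

Lemma hpart_unique (s : seq int) (f : int -> V) v :
  uniq s -> (forall n, comp n (f n)) -> (forall n, n \notin s -> f n = 0) ->
  v = \sum_(n <- s) f n -> forall n, hpart n v = f n.
Proof.
move=> us cf f0 vE n.
pose t := undup (n :: s ++ hsupp v).
have ut : uniq t by apply: undup_uniq.
have c : forall m, comp m (-1 *: hpart m v + f m).
  by move=> m; apply: gradingP => //; apply: hpart_comp.
have E1 : \sum_(m <- t) hpart m v = v.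
  rewrite [RHS]hpart_sum; apply: big_ext => //; first exact: hsupp_uniq.
    by move=> m Hm; rewrite mem_undup inE mem_cat Hm !orbT.
  by move=> m; apply: hpart_out.
have E2 : \sum_(m <- t) f m = v.
  rewrite [RHS]vE; apply: big_ext => //.
  by move=> m Hm; rewrite mem_undup inE mem_cat Hm !orbT.
have : \sum_(m <- t) (-1 *: hpart m v + f m) = 0.
  by rewrite big_split /= -scaler_sumr E1 E2 scaleN1r addNr.
move=> /(grading_indep gr ut c) /(_ n); rewrite mem_undup inE eqxx => /(_ isT).
by rewrite scaleN1r addrC => /eqP; rewrite subr_eq0 => /eqP.
Qed.

Lemma hpart_linear n : linear (hpart n).
Proof.
move=> a u v; pose t := undup (hsupp u ++ hsupp v).
apply: (@hpart_unique t (fun n => a *: hpart n u + hpart n v)).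
- exact: undup_uniq.
- by move=> m; apply: gradingP => //; apply: hpart_comp.
- move=> m; rewrite mem_undup mem_cat negb_or => /andP[H1 H2].
  by rewrite !hpart_out // scaler0 addr0.
- rewrite big_split -scaler_sumr /= {1}(hpart_sum u) {1}(hpart_sum v).
  by congr (_ *: _ + _); apply/esym/big_ext;
    rewrite ?undup_uniq ?hsupp_uniq // => m;
    [move=> H; rewrite mem_undup mem_cat H ?orbT | apply: hpart_out
    |move=> H; rewrite mem_undup mem_cat H ?orbT | apply: hpart_out].
Qed.
HB.instance Definition _ n :=
  GRing.isLinear.Build K V V *:%R (hpart n) (@hpart_linear n).

Lemma hpart_homog n m v : comp n v -> hpart m v = if m == n then v else 0.
Proof.
move=> cv; apply: (@hpart_unique [:: n] (fun m => if m == n then v else 0)) => //.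
- by move=> k; case: eqP => [->//|_]; apply: grading0.
- by move=> k; rewrite inE => /negbTE ->.
- by rewrite big_seq1 eqxx.
Qed.

Lemma hpart_sum_ext (U : lmodType K) (f : int -> {linear V -> U}) t v :
  uniq t -> {subset hsupp v <= t} ->
  \sum_(n <- t) f n (hpart n v) = \sum_(n <- hsupp v) f n (hpart n v).
Proof.
move=> ut st; apply: big_ext => //; first exact: hsupp_uniq.
by move=> n /hpart_out ->; rewrite linear0.
Qed.

(* A family of linear maps f n, applied to the homogeneous parts. *)
Definition hmap (U : lmodType K) (f : int -> {linear V -> U}) (v : V) : U :=
  \sum_(n <- hsupp v) f n (hpart n v).

Lemma hmap_linear (U : lmodType K) (f : int -> {linear V -> U}) : linear (hmap f).
Proof.
move=> a u v; pose t := undup (hsupp (a *: u + v) ++ (hsupp u ++ hsupp v)).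
have ut : uniq t by apply: undup_uniq.
have E w : {subset hsupp w <= t} -> hmap f w = \sum_(n <- t) f n (hpart n w).
  by move=> H; rewrite hpart_sum_ext.
rewrite !E; try by move=> n H; rewrite mem_undup !mem_cat H ?orbT.
rewrite scaler_sumr -big_split; apply: eq_bigr => n _.
by rewrite linearP linearP.
Qed.
HB.instance Definition _ (U : lmodType K) (f : int -> {linear V -> U}) :=
  GRing.isLinear.Build K V U *:%R (hmap f) (hmap_linear f).

Lemma hmap_homog (U : lmodType K) (f : int -> {linear V -> U}) n v :
  comp n v -> hmap f v = f n v.
Proof.
move=> cv; pose t := undup (n :: hsupp v).
have nt : n \in t by rewrite mem_undup inE eqxx.
have -> : hmap f v = \sum_(m <- t) f m (hpart m v).
  rewrite hpart_sum_ext ?undup_uniq // => m H.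
  by rewrite mem_undup inE H orbT.
rewrite (@big_ext _ _ [:: n]) ?undup_uniq //.
- by rewrite big_seq1 (hpart_homog _ cv) eqxx.
- by move=> m; rewrite inE => /eqP ->.
- by move=> m; rewrite inE (hpart_homog _ cv) => /negbTE ->; rewrite linear0.
Qed.
End HomogeneousParts.

Section GradingCriterion.
Variables (K : fieldType) (T : lmodType K) (comp : int -> set T).
Variable pr : int -> {linear T -> T}.
Hypothesis c0 : forall n, comp n 0.
Hypothesis cP : forall n a u v, comp n u -> comp n v -> comp n (a *: u + v).
Hypothesis prE : forall n m t, comp m t -> pr n t = if n == m then t else 0.
Hypothesis cspan : forall t, exists s : seq (int * T),
  (forall p, p \in s -> comp p.1 p.2) /\ t = \sum_(p <- s) p.2.

Lemma grading_of_proj : is_grading comp.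
Proof.
split=> // [t|s f us cf f0 n ns]; last first.
  move: (congr1 (pr n) f0); rewrite linear0 linear_sum (bigD1_seq n) //=.
  rewrite (prE n (cf n)) eqxx big1 ?addr0 // => m mn.
  by rewrite (prE n (cf m)) eq_sym (negbTE mn).
have [s [cs tE]] := cspan t.
exists (undup [seq p.1 | p <- s]), (fun n => pr n t); split.
- exact: undup_uniq.
- move=> n; rewrite tE linear_sum big_seq.
  apply: (@big_ind _ (comp n)) => [//|u v cu cv|p ps].
    by rewrite -[u]scale1r; apply: cP.
  by rewrite (prE n (cs _ ps)); case: (eqVneq n p.1) => [->|_]; [exact: cs | exact: c0].
- rewrite [LHS]tE; transitivity
    (\sum_(n <- undup [seq p.1 | p <- s]) \sum_(p <- s) pr n p.2); last first.
    by apply: eq_bigr => n _; rewrite tE linear_sum.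
  rewrite exchange_big /=; apply: eq_big_seq => p ps.
  have p1 : p.1 \in undup [seq p.1 | p <- s] by rewrite mem_undup map_f.
  rewrite (bigD1_seq p.1) ?undup_uniq //= (prE _ (cs _ ps)) eqxx big1 ?addr0 //.
  by move=> m mp; rewrite (prE _ (cs _ ps)) (negbTE mp).
Qed.
End GradingCriterion.

Section YDTensor.
Variables (K : fieldType) (V W : ydModule K).

Definition tmkr (w : W) (v : V) : tens W V := w \otimes v.
Lemma tmkr_linear w : linear (tmkr w).
Proof. by move=> a x y; rewrite /tmkr linearPr. Qed.
HB.instance Definition _ w :=
  GRing.isLinear.Build K V (tens W V) *:%R (tmkr w) (tmkr_linear w).

Lemma braiding_bilinear : bilinear_for *:%R *:%R
  (fun v w => hmap (fun k => tmkr (yd_act W k w)) v).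
Proof.
split=> [w a x y|v a x y] /=; first by rewrite linearP.
rewrite /hmap scaler_sumr -big_split; apply: eq_bigr => n _ /=.
by rewrite /tmkr linearP linearPl.
Qed.
Definition braiding : {linear tens V W -> tens W V} :=
  tlift (mkbilinear braiding_bilinear).

Lemma braidingE k v w : yd_comp V k v ->
  braiding (v \otimes w) = yd_act W k w \otimes v.
Proof. by move=> cv; rewrite [LHS]tliftE /= (hmap_homog _ cv). Qed.

Definition tens_comp (n : int) : set (tens V W) :=
  [set t | exists s : seq (V * W), t = \sum_(p <- s) p.1 \otimes p.2 /\
     forall p, p \in s ->
       exists i j, [/\ i + j = n, yd_comp V i p.1 & yd_comp W j p.2]].

Definition tens_act (k : int) : {linear tens V W -> tens V W} :=
  tmap (yd_act V k) (yd_act W k).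

Section Proj.
Variable n : int.
Section Fix.
Variables (w : W) (i : int).
Definition tproj1 (v : V) : tens V W := v \otimes hpart (n - i) w.
Lemma tproj1_linear : linear tproj1.
Proof. by move=> a x y; rewrite /tproj1 linearPl. Qed.
HB.instance Definition _ :=
  GRing.isLinear.Build K V (tens V W) *:%R tproj1 tproj1_linear.
End Fix.
Lemma tproj_bilinear : bilinear_for *:%R *:%R (fun v w => hmap (tproj1 w) v).
Proof.
split=> [w a x y|v a x y] /=; first by rewrite linearP.
rewrite /hmap scaler_sumr -big_split; apply: eq_bigr => m _ /=.
by rewrite /tproj1 linearP linearPr.
Qed.
Definition tproj : {linear tens V W -> tens V W} := tlift (mkbilinear tproj_bilinear).
Lemma tproj_pure i j v w : yd_comp V i v -> yd_comp W j w ->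
  tproj (v \otimes w) = if n == i + j then v \otimes w else 0.
Proof.
move=> cv cw; rewrite [LHS]tliftE /= (hmap_homog _ cv) /= /tproj1 (hpart_homog _ cw).
by rewrite subr_eq addrC; case: eqP => // _; rewrite linear0r.
Qed.
End Proj.

Lemma tens_compP n a u v :
  tens_comp n u -> tens_comp n v -> tens_comp n (a *: u + v).
Proof.
move=> [s [-> cs]] [t [-> ct]]; exists ([seq (a *: p.1, p.2) | p <- s] ++ t).
split.
  rewrite big_cat big_map scaler_sumr; congr (_ + _).
  by apply: eq_bigr => p _; rewrite linearZl.
move=> p; rewrite mem_cat => /orP[/mapP[r rs ->]|]; last exact: ct.
have [i [j [ij ci cj]]] := cs _ rs; exists i, j; split=> //=.
rewrite -[_ *: _]addr0; apply: gradingP => //; first exact: yd_grading (yd_ax V).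
exact: grading0 (yd_grading (yd_ax V)) i.
Qed.

Lemma tens_comp0 n : tens_comp n 0.
Proof. by exists [::]; rewrite big_nil. Qed.

Lemma tens_comp_mk i j v w : yd_comp V i v -> yd_comp W j w ->
  tens_comp (i + j) (v \otimes w).
Proof.
move=> cv cw; exists [:: (v, w)]; rewrite big_seq1; split=> // p.
by rewrite inE => /eqP ->; exists i, j.
Qed.

Lemma tens_span t : exists s : seq (int * tens V W),
  (forall p, p \in s -> tens_comp p.1 p.2) /\ t = \sum_(p <- s) p.2.
Proof.
pose P t := exists s : seq (int * tens V W),
  (forall p, p \in s -> tens_comp p.1 p.2) /\ t = \sum_(p <- s) p.2.
have P0 : P 0 by exists [::]; rewrite big_nil.
have PD x y : P x -> P y -> P (x + y).
  move=> [s [cs ->]] [r [cr ->]]; exists (s ++ r); rewrite big_cat; split=> // p.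
  by rewrite mem_cat => /orP[]; [apply: cs | apply: cr].
have [s ->] := tens_sum t; apply: (@big_ind _ P) => // p _.
rewrite (hpart_sum p.1) linear_sumlz; apply: (@big_ind _ P) => // i _.
rewrite (hpart_sum p.2) linear_sumr; apply: (@big_ind _ P) => // j _.
exists [:: (i + j, hpart i p.1 \otimes hpart j p.2)]; rewrite big_seq1; split=> // x.
by rewrite inE => /eqP -> /=; apply: tens_comp_mk; apply: hpart_comp.
Qed.

Lemma tprojE n m t : tens_comp m t -> tproj n t = if n == m then t else 0.
Proof.
move=> [s [-> cs]]; rewrite linear_sum.
transitivity (\sum_(p <- s) if n == m then p.1 \otimes p.2 else 0).
  apply: eq_big_seq => p /cs[i [j [<- ci cj]]]; exact: tproj_pure.
by case: eqP => // _; rewrite big1.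
Qed.

Lemma tens_is_yd : is_yd tens_comp tens_act.
Proof.
split.
- exact: grading_of_proj tens_comp0 tens_compP tprojE tens_span.
- move=> t; have [s ->] := tens_sum t; rewrite linear_sum; apply: eq_bigr => p _.
  by rewrite [LHS]tmapE (yd_act0 (yd_ax V)) (yd_act0 (yd_ax W)).
- move=> k l t; have [s ->] := tens_sum t; 
  rewrite (linear_sum (tens_act (k + l))) (linear_sum (tens_act l)) (linear_sum (tens_act k)).
  apply: eq_bigr => p _.
  by rewrite !tmapE (yd_actD (yd_ax V)) (yd_actD (yd_ax W)).
- move=> k n t [s [-> cs]]; rewrite linear_sum.
  exists [seq (yd_act V k p.1, yd_act W k p.2) | p <- s]; rewrite big_map; split.
    by apply: eq_bigr => p _; rewrite [LHS]tmapE.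
  move=> p /mapP[r /cs[i [j [ij ci cj]]] ->]; exists i, j; split=> //=.
    exact: (yd_act_comp (yd_ax V)).
  exact: (yd_act_comp (yd_ax W)).
Qed.

Definition yd_tens : ydModule K := YDModule tens_is_yd.
End YDTensor.

Section YDUnit.
Variable K : fieldType.

Definition unit_comp (n : int) : set K^o := [set a | n = 0 \/ a = 0].

Lemma unit_is_yd : is_yd unit_comp (fun=> idfun).
Proof.
split=> //; split.
- by move=> n; right.
- move=> n a u v [->|->]; first by left.
  by case=> [->|->]; [left | right; rewrite scaler0 addr0].
- move=> v; exists [:: 0], (fun n => if n == 0 then v else 0).
  split=> //; last by rewrite big_seq1.
  by move=> n; case: eqP => [->|_]; [left | right].
- move=> s f us cf f0 n ns; case: (cf n) => // n0; subst n.
  rewrite (bigD1_seq 0) //= big1 ?addr0 // in f0.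
  by move=> m /eqP m0; case: (cf m).
Qed.

Definition yd_unit : ydModule K := YDModule unit_is_yd.
End YDUnit.

Record is_yd_morph (K : fieldType) (V W : ydModule K) (f : V -> W) : Prop := IsYDMorph {
  yd_morph_comp : forall n v, yd_comp V n v -> yd_comp W n (f v);
  yd_morph_act : forall k v, f (yd_act V k v) = yd_act W k (f v) }.

Section HopfAlgebra.
Variables (K : fieldType) (H : ydModule K).

(* id (x) c_{H,H} (x) id on (H (x) H) (x) (H (x) H) *)
Definition middle_braiding :
    tens (tens H H) (tens H H) -> tens (tens H H) (tens H H) :=
  fun t => tunassoc H H (tens H H)
    (tmap idfun (tassoc H H H)
      (tmap idfun (tmap (braiding H H) idfun)
        (tmap idfun (tunassoc H H H)
          (tassoc H H (tens H H) t)))).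

Lemma middle_braidingE k (a b c d : H) : yd_comp H k b ->
  middle_braiding ((a \otimes b) \otimes (c \otimes d)) =
  (a \otimes yd_act H k c) \otimes (b \otimes d).
Proof.
move=> bk; rewrite /middle_braiding tassocE (tmapE idfun) (tunassocE b c d).
rewrite (tmapE idfun) (tmapE (braiding H H)) (braidingE c bk).
by rewrite (tmapE idfun) (tassocE (yd_act H k c) b d) tunassocE.
Qed.

Record is_hopf_algebra (mu : {linear tens H H -> H}) (eta : {linear K^o -> H})
    (Delta : {linear H -> tens H H}) (eps : {linear H -> K^o})
    (S : {linear H -> H}) : Prop := IsHopf {
  hopf_mu_morph : is_yd_morph (V := yd_tens H H) (W := H) mu;
  hopf_eta_morph : is_yd_morph (V := yd_unit K) (W := H) eta;
  hopf_Delta_morph : is_yd_morph (V := H) (W := yd_tens H H) Delta;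
  hopf_eps_morph : is_yd_morph (V := H) (W := yd_unit K) eps;
  hopf_S_morph : is_yd_morph (V := H) (W := H) S;

  hopf_mulA : forall t, mu (tmap mu idfun t) = mu (tmap idfun mu (tassoc H H H t));
  hopf_mul1l : forall t, mu (tmap eta idfun t) = tlunit H t;
  hopf_mul1r : forall t, mu (tmap idfun eta t) = trunit H t;

  hopf_coA : forall a,
    tassoc H H H (tmap Delta idfun (Delta a)) = tmap idfun Delta (Delta a);
  hopf_co1l : forall a, tlunit H (tmap eps idfun (Delta a)) = a;
  hopf_co1r : forall a, trunit H (tmap idfun eps (Delta a)) = a;

  hopf_DeltaM : forall t,
    Delta (mu t) = tmap mu mu (middle_braiding (tmap Delta Delta t));
  hopf_Delta1 : Delta (eta 1) = eta 1 \otimes eta 1;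
  hopf_epsM : forall a b, eps (mu (a \otimes b)) = eps a * eps b;
  hopf_eps1 : eps (eta 1) = 1;

  hopf_antipode_l : forall a, mu (tmap S idfun (Delta a)) = eta (eps a);
  hopf_antipode_r : forall a, mu (tmap idfun S (Delta a)) = eta (eps a) }.
End HopfAlgebra.

HB.mixin Record hasStar (K : numClosedFieldType) A of GRing.Algebra K A := {
  star : A -> A;
  starK : involutive star;
  starP : forall (a : K) x y, star (a *: x + y) = a^* *: star x + star y;
  starM : forall x y, star (x * y) = star y * star x }.
#[short(type="starAlgType")]
HB.structure Definition StarAlgebra (K : numClosedFieldType) :=
  { A of GRing.Algebra K A & hasStar K A }.

Section RegularStar.
Variable K : numClosedFieldType.
Definition regular_star (x : K^o) : K^o := (x : K)^*.
Lemma regular_starK : involutive regular_star. Proof. exact: conjCK. Qed.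
Lemma regular_starP (a : K) x y :
  regular_star (a *: x + y) = a^* *: regular_star x + regular_star y.
Proof. by rewrite /regular_star rmorphD rmorphM. Qed.
Lemma regular_starM x y : regular_star (x * y) = regular_star y * regular_star x.
Proof. by rewrite /regular_star rmorphM mulrC. Qed.
HB.instance Definition _ :=
  hasStar.Build K K^o regular_starK regular_starP regular_starM.
End RegularStar.

Record is_starhom (K : numClosedFieldType) (A B : starAlgType K) (f : A -> B) :
    Prop := IsStarHom {
  starhom_linear : linear f;
  starhom_monoid : monoid_morphism f;
  starhom_star : forall x, f (star x) = star (f x) }.

(* Unital C*-algebras over the complex numbers R[i]; the zero algebra is excluded
   because algType requires 1 != 0. The norm takes its values among the
   nonnegative reals inside R[i]. *)
HB.mixin Record isCStar (R : realType) A of StarAlgebra R[i] A := {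
  cnorm : A -> R[i];
  cnorm_ge0 : forall x, 0 <= cnorm x;
  cnorm_eq0 : forall x, cnorm x = 0 -> x = 0;
  cnormD : forall x y, cnorm (x + y) <= cnorm x + cnorm y;
  cnormZ : forall (a : R[i]) x, cnorm (a *: x) = `|a| * cnorm x;
  cnormM : forall x y, cnorm (x * y) <= cnorm x * cnorm y;
  cnorm_starM : forall x, cnorm (star x * x) = cnorm x ^+ 2;
  cnorm_complete : forall u : nat -> A,
    (forall e : R[i], 0 < e -> exists N, forall m n, (N <= m)%N -> (N <= n)%N ->
       cnorm (u m - u n) < e) ->
    exists l, forall e : R[i], 0 < e -> exists N, forall n, (N <= n)%N ->
       cnorm (u n - l) < e }.
#[short(type="cstarAlgType")]
HB.structure Definition CStarAlgebra (R : realType) :=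
  { A of StarAlgebra R[i] A & isCStar R A }.

Section GeneratedStarSubalgebra.
Variables (K : numClosedFieldType) (A : starAlgType K).

Record is_star_subalg (P : set A) : Prop := IsStarSubalg {
  star_subalg1 : P 1;
  star_subalgP : forall a x y, P x -> P y -> P (a *: x + y);
  star_subalgM : forall x y, P x -> P y -> P (x * y);
  star_subalg_star : forall x, P x -> P (star x) }.

Definition genstar (X : set A) : {pred A} :=
  fun x => `[< forall P : set A, is_star_subalg P -> X `<=` P -> P x >].

Variable X : set A.

Lemma genstar_closed : subalg_closed (genstar X).
Proof.
split=> [|a x y /asboolP cx /asboolP cy|x y /asboolP cx /asboolP cy];
  apply/asboolP => P sP XP.
- exact: star_subalg1.
- by apply: star_subalgP => //; [apply: cx | apply: cy].
- by apply: star_subalgM => //; [apply: cx | apply: cy].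
Qed.
HB.instance Definition _ :=
  GRing.isSubalgClosed.Build K A (genstar X) genstar_closed.

Lemma genstar_mem x : X x -> x \in genstar X.
Proof. by move=> Xx; apply/asboolP => P _; apply. Qed.

Lemma genstar_star x : x \in genstar X -> star x \in genstar X.
Proof.
by move=> /asboolP cx; apply/asboolP => P sP XP; apply: star_subalg_star (cx _ sP XP).
Qed.

Record star_subalg : predArgType :=
  StarSubalg { star_subalg_val :> A; _ : star_subalg_val \in genstar X }.
HB.instance Definition _ := [isSub for star_subalg_val].
HB.instance Definition _ := [Choice of star_subalg by <:].
HB.instance Definition _ := [SubChoice_isSubAlgebra of star_subalg by <:].

Definition sub_star (x : star_subalg) : star_subalg :=
  StarSubalg (genstar_star (valP x)).
Lemma sub_starK : involutive sub_star.
Proof. by move=> x; apply: val_inj; rewrite /= starK. Qed.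
Lemma sub_starP (a : K) x y : sub_star (a *: x + y) = a^* *: sub_star x + sub_star y.
Proof. by apply: val_inj; rewrite /= starP. Qed.
Lemma sub_starM x y : sub_star (x * y) = sub_star y * sub_star x.
Proof. by apply: val_inj; rewrite /= starM. Qed.
HB.instance Definition _ :=
  hasStar.Build K star_subalg sub_starK sub_starP sub_starM.
End GeneratedStarSubalgebra.

Section CStarNotions.
Variable R : realType.
Local Notation C := R[i].
Implicit Types A B D : cstarAlgType R.

Definition cclosure A (P : set A) : set A :=
  [set x | forall e : C, 0 < e -> exists2 y, P y & cnorm (x - y) < e].

(* D is a completion of the algebraic tensor product B0 (x) B1 (x) B2 for some
   C*-norm: j0, j1 and j2 are the embeddings of the factors. When the factors
   are nuclear, as they are below, there is only one such completion. *)
Record is_cstar_tensor3 (B0 B1 B2 D : cstarAlgType R)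
    (j0 : B0 -> D) (j1 : B1 -> D) (j2 : B2 -> D) : Prop := IsCStarTensor3 {
  ct_hom0 : is_starhom j0;
  ct_hom1 : is_starhom j1;
  ct_hom2 : is_starhom j2;
  ct_comm01 : forall x y, j0 x * j1 y = j1 y * j0 x;
  ct_comm02 : forall x y, j0 x * j2 y = j2 y * j0 x;
  ct_comm12 : forall x y, j1 x * j2 y = j2 y * j1 x;
  ct_alg : exists2 J : {linear tens (tens B0 B1) B2 -> D},
    injective J & forall b x y, J (b \otimes x \otimes y) = j0 b * j1 x * j2 y;
  ct_dense : forall d, cclosure
    [set d' | exists s : seq (B0 * B1 * B2),
       d' = \sum_(p <- s) j0 p.1.1 * j1 p.1.2 * j2 p.2] d }.

Definition upow A (U : A) (n : int) : A :=
  match n with Posz k => U ^+ k | Negz k => star U ^+ k.+1 end.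

Definition is_unitary A (U : A) : Prop := [/\ star U * U = 1 & U * star U = 1].

Record suq2_rel (q : C) A (a c : A) : Prop := SUq2Rel {
  suq2_aa : star a * a + star c * c = 1;
  suq2_aa' : a * star a + `|q| ^+ 2 *: (star c * c) = 1;
  suq2_ac : a * c = q^* *: (c * a);
  suq2_cc : c * star c = star c * c }.

Record torus_rel (zeta : C) A (U V : A) : Prop := TorusRel {
  torus_U : is_unitary U;
  torus_V : is_unitary V;
  torus_UV : U * V = zeta *: (V * U) }.

(* (A, a, c) is the universal unital C*-algebra generated by two elements
   subject to the relations rel. *)
Record is_universal2 (rel : forall B : cstarAlgType R, B -> B -> Prop) A (a c : A) :
    Prop := IsUniversal2 {
  universal2_rel : rel A a c;
  universal2_hom : forall B (b d : B), rel B b d ->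
    exists f : A -> B, [/\ is_starhom f, f a = b, f c = d &
      forall g : A -> B, is_starhom g -> g a = b -> g c = d -> g =1 f] }.

(* A unital *-homomorphism A -> C(T) (x) A = C(T, A); only the values of rho
   at points of the unit circle T matter. *)
Record is_circle_hom A (rho : A -> C -> A) : Prop := IsCircleHom {
  circle_hom : forall l : C, `|l| = 1 -> is_starhom (fun x => rho x l);
  circle_continuous : forall x (l0 : C), `|l0| = 1 -> forall e : C, 0 < e ->
    exists2 d : C, 0 < d &
      forall l : C, `|l| = 1 -> `|l - l0| < d -> cnorm (rho x l - rho x l0) < e }.

(* deg x = n, that is rho x = z^n (x) x *)
Definition homog A (rho : A -> C -> A) (n : int) : set A :=
  [set x | forall l : C, `|l| = 1 -> rho x l = l ^ n *: x].

Section Polynomial.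
Variables (A : cstarAlgType R) (alpha gamma : A).

Definition polA : starAlgType C := star_subalg [set alpha; gamma].
Definition pol_val (a : polA) : A := star_subalg_val a.
Definition pol_alpha : polA := StarSubalg (genstar_mem (or_introl (erefl alpha))).
Definition pol_gamma : polA := StarSubalg (genstar_mem (or_intror (erefl gamma))).
Definition pol_homog (rho : A -> C -> A) (n : int) : set polA :=
  [set a | homog rho n (pol_val a)].
End Polynomial.

(* The closed linear span of the products iota1 x * iota2 y. *)
Definition boxtimes A D (iota1 iota2 : A -> D) : set D :=
  cclosure [set d | exists s : seq (A * A), d = \sum_(p <- s) iota1 p.1 * iota2 p.2].
End CStarNotions.

(* Main.v *)
(** The map [phi : a (x) b |-> iota1 a * iota2 b] is injective: on a
    homogeneous tensor of bidegree (m, n) it is the tensor of the invertible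
    element U^m V^n with a (x) b, and bidegrees are separated by projecting to
    homogeneous parts. Since U V = zeta V U, it carries the braided product to
    the product of D, so Delta is multiplicative for the braided product. The
    elements on which the remaining Hopf axioms hold are stable under left
    multiplication by the generators alpha, gamma and their adjoints, because
    both sides of coassociativity are braided algebra maps and the antipode is
    braided antimultiplicative; the axioms are then checked on the generators.
    The only relation that is not purely algebraic is
    alpha gamma^* = q gamma^* alpha, which uses the C^*-identity. *)

From HB Require Import structures.
Require Import Defs.
From mathcomp Require Import all_boot all_order all_algebra.
From mathcomp Require Import boolp classical_sets reals.
From mathcomp Require Import complex.

Import Order.TTheory GRing.Theory Num.Theory.
Local Open Scope ring_scope.

Set Implicit Arguments.
Unset Strict Implicit.
Unset Printing Implicit Defensive.

(** * Linear algebra and induction principles *)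

Section Splitting.
Variables (K : fieldType) (V W : lmodType K).
Local Open Scope classical_set_scope.

(* A complement of the image is a maximal subspace meeting it trivially; the
   empty set is admitted below because Zorn's lemma is applied to all chains. *)
Lemma linear_inj_compl (f : {linear V -> W}) : injective f ->
  exists N : set W, [/\ (forall a u v, N u -> N v -> N (a *: u + v)), N 0,
    forall v, N (f v) -> v = 0 & forall w, exists v, N (w - f v)].
Proof.
move=> fI.
pose P (N : set W) := (forall a u v, N u -> N v -> N (a *: u + v)) /\
  forall v, N (f v) -> v = 0.
have f0 v : f v = 0 -> v = 0 by move=> E; apply: fI; rewrite E linear0.
have [|N [[Nlin Nim] Nmax]] := @Zorn_bigcup W P.
  move=> F FP Ftot; split=> [a u v [X FX Xu] [Y FY Yv]|v [X FX Xv]]; last first.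
    by have [_] := FP _ FX; apply.
  have [XY|YX] := Ftot _ _ FX FY.
    by exists Y => //; have [H _] := FP _ FY; apply: H => //; apply: XY.
  by exists X => //; have [H _] := FP _ FX; apply: H => //; apply: YX.
(* If 0 were missing, [N] would be empty, since u in [N] gives -u + u in [N]; then the set {0} would
   be strictly larger. *)
have N0 : N 0.
  apply: contrapT => nN0; apply: (Nmax [set 0]).
    split=> [|/(_ 0 erefl)//] u Nu; case: nN0.
    by rewrite -[0](addNr u) -scaleN1r; apply: Nlin.
  by split=> [a u v -> ->|v /f0//]; rewrite /= scaler0 addr0.
exists N; split=> // w; apply: contrapT => nw.
(* A vector w outside [N] plus the image would allow [N] to be enlarged by the line through w: if f
   v = n + c w with c nonzero, then w - f (c^-1 v) lies in [N], a contradiction. *)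
pose N' := [set x | exists c n, N n /\ x = n + c *: w].
apply: (Nmax N').
  split=> [u Nu|/(_ w)]; first by exists 0, u; rewrite scale0r addr0.
  have N'w : N' w by exists 1, 0; rewrite scale1r add0r.
  by move=> /(_ N'w) Nw; apply: nw; exists 0; rewrite linear0 subr0.
split=> [a _ _ [c [n [Nn ->]]] [d [m [Nm ->]]]|v [c [n [Nn fvE]]]].
  exists (a * c + d), (a *: n + m); split; first exact: Nlin.
  by rewrite scalerDr scalerDl scalerA addrACA.
have [c0|c0] := eqVneq c 0.
  by apply: Nim; rewrite fvE c0 scale0r addr0.
case: nw; exists (c^-1 *: v).
rewrite linearZ /= fvE scalerDr scalerA mulVf // scale1r opprD addrC addrNK.
by rewrite -scaleNr -[_ *: _]addr0; apply: Nlin.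
Qed.

(** The retraction is the projection onto the image along the complement [N]. Its value at w is the
    only v with w - f v in [N], which yields both linearity and the retraction property. *)
Lemma linear_inj_retract (f : {linear V -> W}) : injective f ->
  exists g : {linear W -> V}, cancel f g.
Proof.
move=> fI; have [N [Nlin N0 Nim /choice[g Ng]]] := linear_inj_compl fI.
have gE w v : N (w - f v) -> g w = v.
  move=> Nwv; apply/subr0_eq/Nim.
  rewrite linearB (_ : _ - _ = -1 *: (w - f (g w)) + (w - f v)).
    exact: Nlin.
  by rewrite scaleN1r opprB addrA addrNK.
have glin : linear g.
  move=> a x y; apply: gE.
  rewrite linearP opprD addrACA -scalerBr; exact: Nlin.
pose g' : {linear W -> V} := HB.pack g (GRing.isLinear.Build K W V *:%R g glin).
by exists g' => v; apply: gE; rewrite subrr.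
Qed.

End Splitting.

(** The functional is a retraction of the embedding of the line spanned by u. *)
Lemma exists_dual (K : fieldType) (V : lmodType K) (u : V) : u != 0 ->
  exists f : {linear V -> K^o}, f u = 1.
Proof.
move=> u0.
have uI : injective (unit_map u).
  move=> a b /eqP; rewrite -subr_eq0 /unit_map -scalerBl scaler_eq0 (negbTE u0) orbF.
  by rewrite subr_eq0 => /eqP.
have [g gK] := linear_inj_retract uI.
by exists g; rewrite -[RHS]gK; congr (g _); apply/esym/scale1r.
Qed.

Lemma tens_ind (K : fieldType) (V W : lmodType K) (P : tens V W -> Prop) :
  (forall v w, P (v \otimes w)) -> (forall x y, P x -> P y -> P (x + y)) ->
  forall x, P x.
Proof.
move=> Pmk PD x; have [s ->] := tens_sum x.
apply: (@big_ind _ P) => //.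
rewrite -(linear0r (@tmk K V W) 0); exact: Pmk.
Qed.

Section StarSubalgebra.
Variables (K : numClosedFieldType) (A : starAlgType K) (X : set A).
Local Notation H := (star_subalg X).

(** Words in the elements of [X] and their adjoints span the generated star-subalgebra, and each
    word is built by left multiplication with one letter at a time. *)
Lemma star_subalg_ind (P : H -> Prop) : P 1 ->
  (forall a x y, P x -> P y -> P (a *: x + y)) ->
  (forall x y, X (\val x) \/ X (star (\val x)) -> P y -> P (x * y)) ->
  forall x, P x.
Proof.
move=> P1 Plin PM.
(* [W] is the least predicate with the three closure properties. It turns out to be closed under
   products and adjoints, so its image in [A] is a star-subalgebra containing [X], hence
   everything. *)
pose W (x : H) := forall Q : H -> Prop, Q 1 ->
  (forall a x y, Q x -> Q y -> Q (a *: x + y)) ->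
  (forall x y, X (\val x) \/ X (star (\val x)) -> Q y -> Q (x * y)) -> Q x.
have W1 : W 1 by [].
have Wlin a x y : W x -> W y -> W (a *: x + y).
  by move=> Wx Wy Q Q1 Ql QM; apply: (Ql); [apply: Wx|apply: Wy].
have WML x y : X (\val x) \/ X (star (\val x)) -> W y -> W (x * y).
  by move=> Xx Wy Q Q1 Ql QM; apply: (QM) => //; apply: Wy.
have WM x y : W x -> W y -> W (x * y).
  move=> Wx Wy; apply: (Wx (fun x => W (x * y))); first by rewrite mul1r.
    by move=> a u v Wu Wv; rewrite mulrDl -scalerAl; apply: Wlin.
  by move=> u v Xu Wv; rewrite -mulrA; apply: WML.
have Wgen x : X (\val x) \/ X (star (\val x)) -> W x.
  by move=> Xx; rewrite -[x]mulr1; apply: WML.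
have star1 : star (1 : H) = 1.
  by rewrite -[LHS]mul1r -[X in X * _](starK (1 : H)) -starM mul1r starK.
have Wstar x : W x -> W (star x).
  move=> Wx; apply: (Wx (fun x => W (star x))); first by rewrite star1.
    by move=> a u v Wu Wv; rewrite starP; apply: Wlin.
  move=> u v Xu Wv; rewrite starM; apply: WM => //; apply: Wgen.
  by case: Xu; [right; rewrite starK|left].
suff WT x : W x by move=> x; apply: WT.
case: x => x xX; have /asboolP := xX.
move=> /(_ (fun x => exists2 y : H, W y & \val y = x)) [].
- split; first by exists 1.
  + move=> a _ _ [u Wu <-] [v Wv <-]; exists (a *: u + v) => //; exact: Wlin.
  + move=> _ _ [u Wu <-] [v Wv <-]; exists (u * v) => //; exact: WM.
  + move=> _ [u Wu <-]; exists (star u) => //; exact: Wstar.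
- move=> y Xy; exists (StarSubalg (genstar_mem Xy)) => //.
  by apply: Wgen; left.
- by move=> y Wy yE; rewrite (_ : StarSubalg xX = y) //; apply: val_inj.
Qed.

End StarSubalgebra.

(** * Yetter-Drinfeld modules over the integers *)

Lemma yd_ind (K : fieldType) (V : ydModule K) (P : V -> Prop) :
  (forall n v, yd_comp V n v -> P v) -> (forall x y, P x -> P y -> P (x + y)) ->
  forall x, P x.
Proof.
move=> Ph PD x; rewrite (hpart_sum x); apply: (@big_ind _ P) => //.
  exact: (Ph 0) (grading0 (yd_grading (yd_ax V)) 0).
by move=> i _; apply: (Ph i); apply: hpart_comp.
Qed.

Lemma tens_homog_ind (K : fieldType) (V W : ydModule K) (P : tens V W -> Prop) :
  (forall m n v w, yd_comp V m v -> yd_comp W n w -> P (v \otimes w)) ->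
  (forall x y, P x -> P y -> P (x + y)) -> forall x, P x.
Proof.
move=> Ph PD; apply: tens_ind => // v w.
elim/(@yd_ind _ V): v => [m v cv|x y]; last by rewrite linearDl; apply: PD.
elim/(@yd_ind _ W): w => [n w cw|x y]; last by rewrite linearDr; apply: PD.
exact: Ph cv cw.
Qed.

Section DiagonalAction.
Variables (K : fieldType) (zeta : K).
Hypothesis zeta0 : zeta != 0.

(** Stated for a bare family of components and a bare action, because it is used to prove that they
    form a Yetter-Drinfeld module. *)
Definition diag_act (V : lmodType K) (comp : int -> set V)
    (act : int -> {linear V -> V}) :=
  forall k n v, comp n v -> act k v = zeta ^ (- (k * n)) *: v.

Lemma diag_is_yd (V : lmodType K) (comp : int -> set V)
    (act : int -> {linear V -> V}) :
  is_grading comp -> diag_act comp act -> is_yd comp act.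
Proof.
move=> gr actE.
(* This replaces [yd_ind], which presupposes the structure under construction. *)
have span (P : V -> Prop) : (forall n x, comp n x -> P x) -> P 0 ->
    (forall x y, P x -> P y -> P (x + y)) -> forall v, P v.
  move=> Ph P0 PD v; have [s [f [_ cf ->]]] := grading_span gr v.
  by apply: (@big_ind _ P) => // i _; apply: (Ph i).
have cZ n a v : comp n v -> comp n (a *: v).
  move=> cv; rewrite -[_ *: _]addr0; apply: gradingP => //; exact: grading0.
split=> // [v|k l v|k n v cv]; last by rewrite (actE _ _ _ cv); apply: cZ.
- elim/span: v => [n x cx||x y]; last by rewrite linearD => -> ->.
    by rewrite (actE _ _ _ cx) mul0r oppr0 expr0z scale1r.
  by rewrite linear0.
- elim/span: v => [n x cx||x y]; last by rewrite !linearD => -> ->.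
    rewrite !(actE _ n) ?scalerA //; last exact: cZ.
    by rewrite -expfzDr // mulrDl opprD.
  by rewrite !linear0.
Qed.

Definition diag_yd (V : ydModule K) := diag_act (@yd_comp K V) (@yd_act K V).

Lemma yd_unit_diag : diag_yd (yd_unit K).
Proof.
move=> k n v [->|->] /=; last by rewrite scaler0.
by rewrite mulr0 oppr0 expr0z scale1r.
Qed.

Lemma yd_tens_diag (V W : ydModule K) :
  diag_yd V -> diag_yd W -> diag_yd (yd_tens V W).
Proof.
move=> dV dW k n _ [s [-> cs]] /=; rewrite linear_sum scaler_sumr.
apply: eq_big_seq => p /cs[i [j [<- ci cj]]].
rewrite [LHS]tmapE (dV _ _ _ ci) (dW _ _ _ cj) linearZl linearZr /= scalerA.
by rewrite -expfzDr // mulrDr opprD.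
Qed.

(** On a homogeneous vector both actions are the same power of [zeta], since [f] keeps the degree;
    equivariance is thus automatic. *)
Lemma diag_yd_morph (V W : ydModule K) (f : {linear V -> W}) :
  diag_yd V -> diag_yd W ->
  (forall n v, yd_comp V n v -> yd_comp W n (f v)) -> is_yd_morph f.
Proof.
move=> dV dW fc; split=> // k; elim/yd_ind => [n v cv|x y IHx IHy].
  by rewrite (dV _ _ _ cv) (dW _ _ _ (fc _ _ cv)) linearZ.
by rewrite (linearD (yd_act V k)) (linearD f) IHx IHy (linearD f)
  (linearD (yd_act W k)).
Qed.

End DiagonalAction.

Lemma tens_comp_ind (K : fieldType) (V W : ydModule K) n (P : tens V W -> Prop) :
  (forall i j v w, i + j = n -> yd_comp V i v -> yd_comp W j w ->
    P (v \otimes w)) ->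
  P 0 -> (forall x y, P x -> P y -> P (x + y)) ->
  forall t, yd_comp (yd_tens V W) n t -> P t.
Proof.
move=> Pmk P0 PD _ [s [-> cs]]; rewrite big_seq.
by apply: (@big_ind _ P) => // p /cs[i [j [ij ci cj]]]; apply: Pmk ij ci cj.
Qed.

(** * Braided products *)

Section BraidedProduct.
Variables (K : fieldType).
Implicit Types B C : ydModule K.

(* For B = C = H this is convertible to [tmap mB mC \o middle_braiding]; the
   general form also covers the iterated braided tensor products of H. *)
Definition bmul B C (mB : {linear tens B B -> B}) (mC : {linear tens C C -> C}) :
    {linear tens (tens B C) (tens B C) -> tens B C} :=
  tmap mB mC \o (tunassoc B B (tens C C) \o
    (tmap idfun (tassoc B C C) \o
      (tmap idfun (tmap (braiding C B) idfun) \o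
        (tmap idfun (tunassoc C B C) \o tassoc B C (tens B C))))).

Lemma bmulE B C (mB : {linear tens B B -> B}) (mC : {linear tens C C -> C})
    k b c b' c' : yd_comp C k c ->
  bmul mB mC ((b \otimes c) \otimes (b' \otimes c')) =
  mB (b \otimes yd_act B k b') \otimes mC (c \otimes c').
Proof.
move=> ck; rewrite /bmul /= tassocE (tmapE idfun) (tunassocE c b' c').
rewrite (tmapE idfun) (tmapE (braiding C B)) (braidingE b' ck).
by rewrite (tmapE idfun) (tassocE (yd_act B k b') c c') tunassocE tmapE.
Qed.

(** In the product the degree of the right leg c acts on the left leg b'. As [g] keeps that degree
    and [f] commutes with that action, their tensor product is multiplicative. *)
Lemma tmap_bmul B C B' C' (mB : {linear tens B B -> B}) (mC : {linear tens C C -> C})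
    (mB' : {linear tens B' B' -> B'}) (mC' : {linear tens C' C' -> C'})
    (f : {linear B -> B'}) (g : {linear C -> C'}) :
  (forall t, f (mB t) = mB' (tmap f f t)) ->
  (forall t, g (mC t) = mC' (tmap g g t)) ->
  (forall k b, f (yd_act B k b) = yd_act B' k (f b)) ->
  (forall k c, yd_comp C k c -> yd_comp C' k (g c)) ->
  forall t, tmap f g (bmul mB mC t) = bmul mB' mC' (tmap (tmap f g) (tmap f g) t).
Proof.
move=> fM gM fact gdeg; elim/tens_ind => [x y|x y IHx IHy]; last first.
  by rewrite !linearD IHx IHy.
elim/tens_homog_ind: x => [m n b c _ cn|x x' IHx IHx']; last first.
  by rewrite linearDl !linearD IHx IHx'.
elim/tens_ind: y => [b' c'|x x' IHx IHx']; last first.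
  by rewrite linearDr !linearD IHx IHx'.
rewrite (bmulE _ _ _ _ _ cn) !tmapE (bmulE _ _ _ _ _ (gdeg _ _ cn)).
by rewrite fM gM !tmapE fact.
Qed.

Lemma bmul_comp B C (mB : {linear tens B B -> B}) (mC : {linear tens C C -> C}) :
  (forall n t, yd_comp (yd_tens B B) n t -> yd_comp B n (mB t)) ->
  (forall n t, yd_comp (yd_tens C C) n t -> yd_comp C n (mC t)) ->
  forall m n x y, yd_comp (yd_tens B C) m x -> yd_comp (yd_tens B C) n y ->
    yd_comp (yd_tens B C) (m + n) (bmul mB mC (x \otimes y)).
Proof.
move=> mBc mCc m n x y xm yn.
have c0 := tens_comp0 B C (m + n).
have cD u v : tens_comp (m + n) u -> tens_comp (m + n) v ->
    @tens_comp _ B C (m + n) (u + v).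
  by move=> cu cv; rewrite -[u]scale1r; apply: tens_compP.
move: x xm; apply: tens_comp_ind => [i j b c ij ci cj||u v IHu IHv].
- move: y yn; apply: tens_comp_ind => [i' j' b' c' ij' ci' cj'||u v IHu IHv].
  + rewrite (bmulE _ _ _ _ _ cj) -ij -ij' addrACA.
    apply: tens_comp_mk; [apply: mBc|apply: mCc]; apply: tens_comp_mk => //.
    exact: yd_act_comp (yd_ax B) _ _ _ ci'.
  + by rewrite linear0r linear0.
  + by rewrite linearDr linearD; apply: cD.
- by rewrite linear0l linear0.
- by rewrite linearDl linearD; apply: cD.
Qed.

Lemma yd_tens_actE B C k (b : B) (c : C) :
  yd_act (yd_tens B C) k (b \otimes c) = yd_act B k b \otimes yd_act C k c.
Proof. exact: tmapE. Qed.

(** On the left, b' is acted on by the degree of e and then by that of c; on the right it is acted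
    on once by the degree of c ⊗ e. These agree because the action is additive in the integer. *)
Lemma tassoc_bmul B C (E : ydModule K) (mB : {linear tens B B -> B})
    (mC : {linear tens C C -> C}) (mE : {linear tens E E -> E}) t :
  tassoc B C E (bmul (B := yd_tens B C) (bmul mB mC) mE t) =
  bmul (C := yd_tens C E) mB (bmul mC mE)
    (tmap (tassoc B C E) (tassoc B C E) t).
Proof.
elim/tens_ind: t => [x y|x y IHx IHy]; last by rewrite !linearD IHx IHy.
elim/tens_homog_ind: x => [m n bc e _ cn|x x' IHx IHx']; last first.
  by rewrite linearDl !linearD IHx IHx'.
elim/tens_homog_ind: bc => [i j b c _ cj|x x' IHx IHx']; last first.
  by rewrite !(linearDl, linearD) IHx IHx'.
elim/tens_ind: y => [bc' e'|x x' IHx IHx']; last first.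
  by rewrite linearDr !linearD IHx IHx'.
elim/tens_ind: bc' => [b' c'|x x' IHx IHx']; last first.
  by rewrite !(linearDl, linearDr, linearD) IHx IHx'.
rewrite (bmulE _ _ _ _ _ cn) yd_tens_actE (bmulE _ _ _ _ _ cj) tassocE tmapE.
rewrite !tassocE.
rewrite (bmulE (C := yd_tens C E) mB _ _ _ _ (tens_comp_mk cj cn)).
by rewrite (bmulE _ _ _ _ _ cn) (yd_actD (yd_ax B)).
Qed.
End BraidedProduct.

(** * Braided Hopf algebras from generators *)

Section HopfFromGenerators.
Variables (K : fieldType) (zeta : K).
Hypothesis zeta0 : zeta != 0.
Variables (H : algType K) (comp : int -> set H) (act : int -> {linear H -> H}).
Hypothesis h : is_yd comp act.
Hypothesis actE : diag_act zeta comp act.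
Hypothesis comp1 : comp 0 1.
Hypothesis compM : forall m n x y, comp m x -> comp n y -> comp (m + n) (x * y).
Local Notation Y := (YDModule h).
Local Notation mu := (mul_map H).

Variables (Delta : {linear H -> tens H H}) (eps : {linear H -> K^o})
  (S : {linear H -> H}).
Hypothesis Delta_mul : forall x y,
  Delta (x * y) = bmul (B := Y) (C := Y) mu mu (Delta x \otimes Delta y).
Hypothesis Delta1 : Delta 1 = 1 \otimes 1.
Hypothesis epsM : forall x y, eps (x * y) = eps x * eps y.
Hypothesis eps1 : eps 1 = 1.
Hypothesis S1 : S 1 = 1.
Hypothesis S_comp : forall n x, comp n x -> comp n (S x).
Hypothesis SM : forall m n x y, comp m x -> comp n y ->
  S (x * y) = zeta ^ (- (m * n)) *: (S y * S x).

Variable gen : set H.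
Hypothesis gen_ind : forall P : H -> Prop, P 1 ->
  (forall k x y, P x -> P y -> P (k *: x + y)) ->
  (forall x y, gen x -> P y -> P (x * y)) -> forall x, P x.
Hypothesis gen_deg : forall x, gen x -> exists d,
  [/\ comp d x, yd_comp (yd_tens Y Y) d (Delta x) & d != 0 -> eps x = 0].
Hypothesis gen_coA : forall x, gen x ->
  tassoc H H H (tmap Delta idfun (Delta x)) = tmap idfun Delta (Delta x).
Hypothesis gen_co1l : forall x, gen x -> tlunit H (tmap eps idfun (Delta x)) = x.
Hypothesis gen_co1r : forall x, gen x -> trunit H (tmap idfun eps (Delta x)) = x.
Hypothesis gen_Sl : forall x, gen x -> mu (tmap S idfun (Delta x)) = eps x *: 1.
Hypothesis gen_Sr : forall x, gen x -> mu (tmap idfun S (Delta x)) = eps x *: 1.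

Local Notation bmu := (bmul (B := Y) (C := Y) mu mu).
Local Notation YY := (yd_tens Y Y).

Lemma DeltaM t : Delta (mu t) = bmu (tmap Delta Delta t).
Proof.
elim/tens_ind: t => [x y|x y IHx IHy]; last by rewrite !linearD IHx IHy.
by rewrite mul_mapE tmapE Delta_mul.
Qed.

Lemma act_mul k x y : act k (x * y) = act k x * act k y.
Proof.
elim/(@yd_ind _ Y): x => [m x xm|x x' IHx IHx']; last first.
  by rewrite mulrDl !(linearD (act k)) IHx IHx' mulrDl.
elim/(@yd_ind _ Y): y => [n y yn|y y' IHx IHx']; last first.
  by rewrite mulrDr !(linearD (act k)) IHx IHx' mulrDr.
rewrite (actE _ xm) (actE _ yn) (actE _ (compM xm yn)).
by rewrite -scalerAl -scalerAr scalerA -expfzDr // mulrDr opprD.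
Qed.

Lemma mu_comp n t : yd_comp YY n t -> comp n (mu t).
Proof.
move: t; apply: tens_comp_ind => [i j x y <- xi yj||x y cx cy].
- by rewrite mul_mapE; apply: compM.
- by rewrite linear0; apply: (grading0 (yd_grading h)).
- rewrite linearD -[mu x]scale1r; exact: (gradingP (yd_grading h)).
Qed.

Lemma hpart_mul d n x y : comp d x ->
  hpart (V := Y) n (x * y) = x * hpart (V := Y) (n - d) y.
Proof.
move=> xd; elim/(@yd_ind _ Y): y => [m y ym|y y' IHx IHx']; last first.
  by rewrite mulrDr !(linearD (hpart _)) /= IHx IHx' mulrDr.
rewrite (hpart_homog (V := Y) _ (compM xd ym)) (hpart_homog (V := Y) _ ym).
by rewrite subr_eq addrC; case: eqP => //; rewrite mulr0.
Qed.

(** Sums mix degrees, so [gen_ind] is run on the claim that every homogeneous part of x satisfies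
    [P] in its own degree; left multiplication by a generator of degree d shifts the parts by d. *)
Lemma graded_gen_ind (P : int -> H -> Prop) : (forall n, P n 0) -> P 0 1 ->
  (forall n k x y, P n x -> P n y -> P n (k *: x + y)) ->
  (forall d n x y, comp d x -> yd_comp YY d (Delta x) ->
    (d != 0 -> eps x = 0) -> P n y -> P (d + n) (x * y)) ->
  forall n x, comp n x -> P n x.
Proof.
move=> P0 P1 Plin PM n x xn.
suff: forall m, P m (hpart (V := Y) m x).
  by move=> /(_ n); rewrite (hpart_homog (V := Y) _ xn) eqxx.
elim/gen_ind: {n xn} x => [|k x y Px Py|x y gx Py] m.
- by rewrite (hpart_homog (V := Y) _ comp1); case: eqP => [->|].
- by rewrite linearP; apply: Plin.
- have [d [xd Dd e0]] := gen_deg gx; rewrite (hpart_mul _ _ xd).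
  by rewrite -[X in P X _](addrNK d) [X in P X _]addrC; apply: PM.
Qed.

Lemma Delta_comp n x : comp n x -> yd_comp YY n (Delta x).
Proof.
move: n x; apply: graded_gen_ind => [n||n k x y|d n x y _ Dx _ Dy].
- by rewrite linear0; apply: tens_comp0.
- by rewrite Delta1 -[0]addr0; apply: (tens_comp_mk (V := Y) (W := Y)).
- by rewrite linearP; apply: tens_compP.
- by rewrite Delta_mul; apply: (bmul_comp mu_comp mu_comp).
Qed.

Lemma eps_comp n x : comp n x -> n != 0 -> eps x = 0.
Proof.
move: n x; apply: graded_gen_ind => [n|//|n k x y ex ey n0|d n x y _ _ ex ey dn0].
- by rewrite linear0.
- by rewrite linearP ex // ey // scaler0 addr0.
- rewrite epsM; have [d0|/ex->] := eqVneq d 0; last by rewrite mul0r.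
  by rewrite ey ?mulr0 //; move: dn0; rewrite d0 add0r.
Qed.

Lemma act_morph (V : ydModule K) (f : {linear H -> V}) : diag_yd zeta V ->
  (forall n x, comp n x -> yd_comp V n (f x)) -> is_yd_morph (V := Y) f.
Proof. exact: (diag_yd_morph (V := Y) actE). Qed.

Lemma eps_act k x : eps (act k x) = eps x.
Proof.
have := yd_morph_act
  (act_morph (V := yd_unit K) (f := eps) (@yd_unit_diag _ zeta) _).
apply => n y yn; have [n0|n0] := eqVneq n 0; first by left.
by right; rewrite (eps_comp yn).
Qed.

Lemma S_act k x : S (act k x) = act k (S x).
Proof. exact: (yd_morph_act (act_morph (V := Y) (f := S) actE S_comp)). Qed.

Lemma YY_diag : diag_yd zeta YY.
Proof. exact: yd_tens_diag zeta0 Y Y actE actE. Qed.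

Lemma Delta_act k x : Delta (act k x) = yd_act YY k (Delta x).
Proof. exact: (yd_morph_act (act_morph (V := YY) YY_diag Delta_comp)). Qed.

(** The scalar in [SM] is the one by which d acts on y. Written as an action, the rule makes sense
    for inhomogeneous y. *)
Lemma S_mul d x y : comp d x -> S (x * y) = S (act d y) * S x.
Proof.
move=> xd; elim/(@yd_ind _ Y): y => [n y yn|y y' IHx IHx']; last first.
  by rewrite mulrDr (linearD (act _)) !(linearD S) mulrDl IHx IHx'.
by rewrite (SM xd yn) (actE _ yn) linearZ /= -scalerAl.
Qed.

Lemma coA x : tassoc H H H (tmap Delta idfun (Delta x)) = tmap idfun Delta (Delta x).
Proof.
elim/gen_ind: x => [|k x y IHx IHy|x y gx IHy].
- by rewrite Delta1 !tmapE Delta1 tassocE.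
- by rewrite !linearP IHx IHy.
have idM t : idfun (mu t) = mu (tmap idfun idfun t) :> H.
  by elim/tens_ind: t => [u v|u v]; rewrite ?tmapE // !linearD /= => -> ->.
(* Both iterated comultiplications are multiplicative into the triple braided product. [Dl] rests on
   the equivariance of [Delta], which stands in the left leg, and [Dr] on its preservation of
   degrees. *)
have Dl t : tmap Delta idfun (bmu t) =
    bmul (B := YY) (C := Y) bmu mu (tmap (tmap Delta idfun) (tmap Delta idfun) t).
  exact: (@tmap_bmul _ Y Y YY Y mu mu bmu mu Delta idfun DeltaM idM Delta_act).
have Dr t : tmap idfun Delta (bmu t) =
    bmul (B := Y) (C := YY) mu bmu (tmap (tmap idfun Delta) (tmap idfun Delta) t).
  exact: (@tmap_bmul _ Y Y Y YY mu mu mu bmu idfun Delta idM DeltaM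
    (fun _ _ => erefl) Delta_comp).
have tA t : tassoc H H H (bmul (B := YY) (C := Y) bmu mu t) =
    bmul (B := Y) (C := YY) mu bmu (tmap (tassoc H H H) (tassoc H H H) t).
  exact: (tassoc_bmul (B := Y) (C := Y) (E := Y)).
rewrite Delta_mul Dl Dr tA (tmapE (tmap Delta idfun)) (tmapE (tassoc H H H)).
by rewrite (tmapE (tmap idfun Delta)) (gen_coA gx) IHy.
Qed.

(** The braiding acts on the left leg of the second factor, and [eps] does not see this action, so
    the left counit map is multiplicative. *)
Lemma co1l x : tlunit H (tmap eps idfun (Delta x)) = x.
Proof.
elim/gen_ind: x => [|k x y IHx IHy|x y gx IHy].
- by rewrite Delta1 tmapE eps1 tlunitE scale1r.
- by rewrite !linearP IHx IHy.
rewrite Delta_mul -{2}(gen_co1l gx) -{2}IHy.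
elim/(@tens_homog_ind _ Y Y): (Delta x) => [_ n u v _ vn|u v IHu IHv]; last first.
  by rewrite linearDl !linearD IHu IHv mulrDl.
elim/tens_ind: (Delta y) => [u' v'|u' v' IHu IHv]; last first.
  by rewrite linearDr !linearD IHu IHv mulrDr.
rewrite (bmulE (B := Y) (C := Y) _ _ _ _ _ vn) !tmapE !tlunitE !mul_mapE /=.
by rewrite epsM eps_act -scalerAl -scalerAr scalerA.
Qed.

Lemma co1r x : trunit H (tmap idfun eps (Delta x)) = x.
Proof.
elim/gen_ind: x => [|k x y IHx IHy|x y gx IHy].
- by rewrite Delta1 tmapE eps1 trunitE scale1r.
- by rewrite !linearP IHx IHy.
rewrite Delta_mul -{2}(gen_co1r gx) -{2}IHy.
elim/(@tens_homog_ind _ Y Y): (Delta x) => [_ n u v _ vn|u v IHu IHv]; last first.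
  by rewrite linearDl !linearD IHu IHv mulrDl.
elim/tens_ind: (Delta y) => [u' v'|u' v' IHu IHv]; last first.
  by rewrite linearDr !linearD IHu IHv mulrDr.
rewrite (bmulE (B := Y) (C := Y) _ _ _ _ _ vn) !tmapE !trunitE !mul_mapE /=.
rewrite epsM -scalerAl -scalerAr scalerA.
(* The left leg u' is twisted by the degree n of v. Either n = 0 and the twist is trivial, or
   [eps v] vanishes and kills both sides. *)
have [n0|n0] := eqVneq n 0; last by rewrite (eps_comp vn) // !(scale0r, mul0r).
by rewrite n0 (yd_act0 h).
Qed.

Lemma antipode_l x : mu (tmap S idfun (Delta x)) = eps x *: 1.
Proof.
elim/gen_ind: x => [|k x y IHx IHy|x y gx IHy].
- by rewrite Delta1 tmapE mul_mapE S1 mulr1 eps1 scale1r.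
- by rewrite !linearP IHx IHy scalerDl scalerA.
have [d [xd Dd ed]] := gen_deg gx.
(* For b ⊗ c of bidegree (i, j), [S_mul] turns the left leg into S of u moved by j and then i, times
   S b. The total twist is by i + j = d, the same for all terms of [Delta x], so it can be taken out
   of the sum. *)
have Dl u v : mu (tmap S idfun (bmu (Delta x \otimes (u \otimes v)))) =
    S (act d u) * mu (tmap S idfun (Delta x)) * v.
  move: (Delta x) Dd.
  apply: (tens_comp_ind (V := Y) (W := Y)) => [i j b c ij bi cj||b c IHb IHc].
  - rewrite (bmulE (B := Y) (C := Y) _ _ _ _ _ cj) !tmapE !mul_mapE /=.
    by rewrite (S_mul _ bi) -(yd_actD h) ij !mulrA.
  - by rewrite linear0l !linear0 mulr0 mul0r.
  - by rewrite linearDl !linearD IHb IHc mulrDr mulrDl.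
rewrite Delta_mul epsM -scalerA -IHy.
elim/tens_ind: (Delta y) => [u v|u v IHu IHv]; last first.
  by rewrite linearDr !linearD IHu IHv.
rewrite Dl (gen_Sl gx) tmapE mul_mapE /= -scalerAr mulr1 -scalerAl.
(* The twist by d is harmless: it is trivial for d = 0, and otherwise [eps x] = 0. *)
have [d0|/ed->] := eqVneq d 0; last by rewrite !scale0r.
by rewrite d0 (yd_act0 h).
Qed.

Lemma antipode_r x : mu (tmap idfun S (Delta x)) = eps x *: 1.
Proof.
elim/gen_ind: x => [|k x y IHx IHy|x y gx IHy].
- by rewrite Delta1 tmapE mul_mapE S1 mulr1 eps1 scale1r.
- by rewrite !linearP IHx IHy scalerDl scalerA.
have act1 k : act k 1 = 1 by rewrite (actE _ comp1) mulr0 oppr0 expr0z scale1r.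
(* The degree k of c acts on u through the braiding and on v through [S_mul]. Being multiplicative,
   the action is then applied to the whole antipode expression of y, a multiple of 1, which it
   fixes. *)
have Dl k b c : comp k c ->
    mu (tmap idfun S (bmu ((b \otimes c) \otimes Delta y))) =
    b * act k (mu (tmap idfun S (Delta y))) * S c.
  move=> ck; elim/tens_ind: (Delta y) => [u v|u v IHu IHv]; last first.
    by rewrite linearDr !linearD IHu IHv mulrDr mulrDl.
  rewrite (bmulE (B := Y) (C := Y) _ _ _ _ _ ck) !tmapE !mul_mapE /=.
  by rewrite (S_mul _ ck) S_act act_mul !mulrA.
rewrite Delta_mul epsM mulrC -scalerA -(gen_Sr gx).
elim/(@tens_homog_ind _ Y Y): (Delta x) => [_ n u v _ vn|u v IHu IHv]; last first.
  by rewrite linearDl !linearD IHu IHv.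
rewrite (Dl _ _ _ vn) IHy linearZ /= act1 tmapE mul_mapE /=.
by rewrite -scalerAr mulr1 -scalerAl.
Qed.

Theorem hopf_of_generators :
  is_hopf_algebra (H := Y) mu (unit_map (1 : H)) Delta eps S.
Proof.
split.
- exact: (@diag_yd_morph _ _ YY Y mu YY_diag actE mu_comp).
- apply: (@diag_yd_morph _ _ (yd_unit K) Y _ (@yd_unit_diag _ zeta) actE).
  move=> n k [->|->]; rewrite /= /unit_map.
    rewrite -[_ *: _]addr0; apply: (gradingP (yd_grading h)) => //.
    exact: (grading0 (yd_grading h)).
  by rewrite scale0r; apply: (grading0 (yd_grading h)).
- exact: (act_morph (V := YY) YY_diag Delta_comp).
- apply: (act_morph (V := yd_unit K) (@yd_unit_diag _ zeta)) => n x xn /=.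
  by have [->|n0] := eqVneq n 0; [left|right; rewrite (eps_comp xn)].
- exact: (act_morph (V := Y) actE S_comp).
- elim/tens_ind => [x y|x y IHx IHy]; last by rewrite !linearD IHx IHy.
  elim/tens_ind: x => [x z|x z IHx IHy].
    by rewrite tassocE !tmapE !mul_mapE /= mulrA.
  by rewrite linearDl !linearD IHx IHy.
- elim/tens_ind => [k x|x y IHx IHy]; last by rewrite !linearD IHx IHy.
  by rewrite tmapE mul_mapE tlunitE /= /unit_map -scalerAl mul1r.
- elim/tens_ind => [x k|x y IHx IHy]; last by rewrite !linearD IHx IHy.
  by rewrite tmapE mul_mapE trunitE /= /unit_map -scalerAr mulr1.
- exact: coA.
- exact: co1l.
- exact: co1r.
- exact: DeltaM.
- by rewrite /= /unit_map scale1r.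
- by move=> x y; rewrite mul_mapE epsM.
- by rewrite /= /unit_map scale1r.
- exact: antipode_l.
- exact: antipode_r.
Qed.
End HopfFromGenerators.

(** * Homogeneous parts and injectivity of twisted tensor maps *)

Section Gradings.
Variables (K : fieldType).

Lemma grading_of_span (V : lmodType K) (comp : int -> set V) :
  (forall n, comp n 0) ->
  (forall n a u v, comp n u -> comp n v -> comp n (a *: u + v)) ->
  (forall v, exists s : seq (int * V),
    (forall p, p \in s -> comp p.1 p.2) /\ v = \sum_(p <- s) p.2) ->
  (forall (s : seq int) (f : int -> V), uniq s -> (forall n, comp n (f n)) ->
    \sum_(n <- s) f n = 0 -> forall n, n \in s -> f n = 0) ->
  is_grading comp.
Proof.
move=> c0 cP span indep; split=> // v; have [s [cs ->]] := span v.
exists (undup (map fst s)), (fun n => \sum_(p <- s | p.1 == n) p.2); split.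
- exact: undup_uniq.
- move=> n; rewrite big_seq_cond.
  apply: (@big_ind _ (comp n)) => // [u w cu cw|p /andP[ps /eqP <-]].
    by rewrite -[u]scale1r; apply: cP.
  exact: cs.
- rewrite (exchange_big_dep xpredT) //=; apply: eq_big_seq => p ps.
  have p1 : p.1 \in undup (map fst s) by rewrite mem_undup map_f.
  rewrite -big_filter (_ : filter _ _ = [:: p.1]) ?big_seq1 //.
  rewrite -(filter_pred1_uniq (undup_uniq _) p1); apply: eq_filter => n.
  exact: eq_sym.
Qed.

Lemma hpart2_eq0 (V W : ydModule K) (x : tens V W) :
  (forall m n, tmap (hpart (V := V) m) (hpart (V := W) n) x = 0) -> x = 0.
Proof.
(* The expansion of x into bihomogeneous parts is claimed for every list containing [s], so that two
   tensors can be expanded over a common list. *)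
suff [s sE] : exists s : seq int, forall t, uniq t -> {subset s <= t} ->
    x = \sum_(m <- t) \sum_(n <- t) tmap (hpart (V := V) m) (hpart (V := W) n) x.
  move=> x0; rewrite (sE (undup s)) ?undup_uniq //; last first.
    by move=> n; rewrite mem_undup.
  by apply: big1 => m _; apply: big1.
elim/tens_ind: x => [v w|x y [s sE] [r rE]].
  exists (hsupp v ++ hsupp w) => t ut st.
  under eq_bigr do [under eq_bigr do rewrite tmapE; rewrite -linear_sumr].
  rewrite -linear_sumlz.
  have tE (Z : ydModule K) (z : Z) : {subset hsupp z <= t} ->
      \sum_(n <- t) hpart n z = z.
    by move=> /(hpart_sum_ext (fun=> idfun) ut) /= ->; rewrite -hpart_sum.
  by rewrite !tE // => n ns; apply: st; rewrite mem_cat ns ?orbT.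
exists (s ++ r) => t ut st.
have {}sE := sE t ut; have {}rE := rE t ut.
apply: etrans (congr2 +%R (sE _) (rE _)) _.
- by move=> n ns; apply: st; rewrite mem_cat ns.
- by move=> n nr; apply: st; rewrite mem_cat nr orbT.
rewrite -big_split; apply: eq_bigr => m _; rewrite -big_split.
by apply: eq_bigr => n _; rewrite linearD.
Qed.

(* Distinct bidegrees are separated by functionals on T, which exist because
   injective linear maps between vector spaces split. *)
Lemma twisted_tens_inj (V W : ydModule K) (T A B D : lmodType K)
    (J : {linear tens (tens T A) B -> D}) (f : {linear V -> A})
    (g : {linear W -> B}) (u : int -> int -> T) (phi : {linear tens V W -> D}) :
  injective J -> injective f -> injective g -> (forall m n, u m n != 0) ->
  (forall m n v w, yd_comp V m v -> yd_comp W n w ->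
    phi (v \otimes w) = J (u m n \otimes f v \otimes g w)) ->
  injective phi.
Proof.
move=> Jinj finj ginj u0 phiE x1 x2 /eqP; rewrite -subr_eq0 -linearB => /eqP phix.
apply/subr0_eq; move: (x1 - x2) phix => x phix {x1 x2}.
have [r fK] := linear_inj_retract finj; have [s gK] := linear_inj_retract ginj.
(* [G F m n] evaluates [F] on the first leg, retracts the other two to [V] and [W], and takes the
   part of bidegree (m, n). If F (u m n) = 1 it undoes the twist on that bidegree; on the others it
   gives 0, whatever [F] does there. *)
pose G (F : {linear T -> K^o}) m n : {linear tens (tens T A) B -> tens V W} :=
  tmap (tlunit V \o tmap F (hpart (V := V) m \o r)) (hpart (V := W) n \o s).
(* [J] is only injective, so a preimage y of [phi x] is built along with x. *)
have [y [yE Gy]] : exists y, J y = phi x /\ forall m n (F : {linear T -> K^o}),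
    F (u m n) = 1 -> G F m n y = tmap (hpart (V := V) m) (hpart (V := W) n) x.
  elim/tens_homog_ind: {phix} x => [i j v w vi wj|x x' [y [yE Gy]] [y' [yE' Gy']]].
    exists (u i j \otimes f v \otimes g w); split=> [|m n F Fu].
      by rewrite (phiE _ _ _ _ vi wj).
    rewrite /G !tmapE /= !tmapE tlunitE /= fK gK.
    rewrite (hpart_homog _ vi) (hpart_homog _ wj).
    case: eqP Fu => [->|_] Fu; last by rewrite scaler0 !linear0l.
    case: eqP Fu => [->|_] Fu; last by rewrite !linear0r.
    by rewrite Fu scale1r.
  exists (y + y'); split=> [|m n F Fu]; first by rewrite !linearD yE yE'.
  by rewrite !linearD Gy // Gy'.
have y0 : y = 0 by apply: Jinj; rewrite yE phix linear0.
apply: hpart2_eq0 => m n; have [F Fu] := exists_dual (u0 m n).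
by rewrite -(Gy _ _ _ Fu) y0 linear0.
Qed.
End Gradings.

(** * Independence of the characters of the circle *)

Section Circle.
Variable C : numClosedFieldType.

Lemma circle_expz_neq1 (k : int) : k != 0 -> exists2 w : C, `|w| = 1 & w ^ k != 1.
Proof.
suff pos n : (0 < n)%N -> exists2 w : C, `|w| = 1 & w ^+ n != 1.
  case: k => n; first by rewrite eqz_nat -lt0n; apply: pos.
  move=> _; have [//|w w1 wn] := pos n.+1; exists w => //.
  by rewrite NegzE -exprz_inv -exprnP exprVn invr_eq1.
(* The witness is an n-th root of -1: its modulus has n-th power 1, and -1 differs from 1. *)
move=> n0; have wE := rootCK n0 (-1 : C); exists (n.-root (-1)).
  apply/eqP; rewrite -(@pexpr_eq1 _ _ n) // -normrX wE normrN1 //.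
rewrite wE; apply/eqP => /eqP.
by rewrite -subr_eq0 -opprD oppr_eq0 (_ : 1 + 1 = 2%:R) // pnatr_eq0.
Qed.

(** This is the classical argument for independence of characters. The relation at l w minus w^m
    times the relation at l has no term of index m, so the induction hypothesis applies; w is chosen
    so that the new coefficient of f n is nonzero. *)
Lemma circle_indep (V : lmodType C) (s : seq int) (f : int -> V) : uniq s ->
  (forall l : C, `|l| = 1 -> \sum_(n <- s) l ^ n *: f n = 0) ->
  forall n, n \in s -> f n = 0.
Proof.
elim: s f => [//|m s IHs] f /= /andP[ms us] sum0.
have fs n : n \in s -> f n = 0.
  move=> ns; have nm : n - m != 0.
    by rewrite subr_eq0; apply: contraNneq ms => <-.
  have [w w1 wnm] := circle_expz_neq1 nm.
  have w0 : w != 0 by rewrite -normr_eq0 w1 oner_eq0.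
  have /(IHs (fun k => (w ^ k - w ^ m) *: f k) us)/(_ n ns)/eqP : forall l : C,
      `|l| = 1 -> \sum_(k <- s) l ^ k *: ((w ^ k - w ^ m) *: f k) = 0.
    move=> l l1; have lw1 : `|l * w| = 1 by rewrite normrM l1 w1 mulr1.
    have l0 : l != 0 by rewrite -normr_eq0 l1 oner_eq0.
    transitivity (\sum_(k <- m :: s) (l * w) ^ k *: f k -
        w ^ m *: \sum_(k <- m :: s) l ^ k *: f k); last first.
      by rewrite !sum0 // scaler0 subr0.
    rewrite scaler_sumr -sumrB big_cons exprzMl ?unitfE // scalerA mulrC subrr.
    rewrite add0r; apply: eq_bigr => k _; rewrite exprzMl ?unitfE // !scalerA.
    by rewrite -scalerBl mulrBr [w ^ m * _]mulrC.
  rewrite scaler_eq0 subr_eq0 => /orP[/eqP wE|/eqP//].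
  by case/eqP: wnm; rewrite expfzDr // wE -expfzDr // subrr expr0z.
move=> n; rewrite inE => /predU1P[->|/fs//].
have := sum0 1 (normr1 _); rewrite big_cons big_seq big1 => [|k /fs->].
  by rewrite addr0 exp1rz scale1r.
by rewrite scaler0.
Qed.
End Circle.

(** * The braided quantum SU(2) group *)

Section StarAlgebraTheory.
Variables (K : numClosedFieldType) (A : starAlgType K).
Implicit Types x y : A.

Lemma star0 : star (0 : A) = 0.
Proof.
by have := starP (-1) (0 : A) 0; rewrite scaler0 addr0 rmorphN1 scaleN1r addNr.
Qed.

Lemma starZ a x : star (a *: x) = a^* *: star x.
Proof. by rewrite -[a *: x]addr0 starP star0 addr0. Qed.

Lemma starD x y : star (x + y) = star x + star y.
Proof. by rewrite -[x]scale1r starP rmorph1 !scale1r. Qed.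

Lemma starN x : star (- x) = - star x.
Proof. by rewrite -scaleN1r starZ rmorphN1 scaleN1r. Qed.

Variables (B : starAlgType K) (f : A -> B).
Hypothesis hf : is_starhom f.

Lemma starhomM x y : f (x * y) = f x * f y.
Proof. by have [_ ->] := starhom_monoid hf. Qed.

Lemma starhom1 : f 1 = 1.
Proof. by have [-> _] := starhom_monoid hf. Qed.

Lemma starhom0 : f 0 = 0.
Proof.
by have := starhom_linear hf (-1) 0 0; rewrite scaler0 addr0 scaleN1r addNr.
Qed.

Lemma starhomZ a x : f (a *: x) = a *: f x.
Proof. by rewrite -[a *: x]addr0 (starhom_linear hf) starhom0 addr0. Qed.

Lemma starhomD x y : f (x + y) = f x + f y.
Proof. by rewrite -[x]scale1r (starhom_linear hf) !scale1r. Qed.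

Lemma starhom_sum I (r : seq I) (P : pred I) (F : I -> A) :
  f (\sum_(i <- r | P i) F i) = \sum_(i <- r | P i) f (F i).
Proof. exact: (big_morph f starhomD starhom0). Qed.
End StarAlgebraTheory.

(** * Further commutation relations between the generators *)

Section QuantumSU2Relations.
Variables (R : realType) (q : R[i]) (A : cstarAlgType R) (a c : A).
Hypothesis rel : suq2_rel q a c.

(* X := a c^* - q c^* a satisfies X X^* = 0. *)
Lemma suq2_acstar : a * star c = q *: (star c * a).
Proof.
have [aa aa' ac cc] := rel.
set X := a * star c - q *: (star c * a); set Z := star c * c.
set t := `|q| ^+ 2 in aa'; have tE : t = q * q^* by rewrite -normCK.
pose W := a * star a.
have WE : W = 1 - t *: Z by rewrite -aa' addrK.
have ZE : Z = 1 - star a * a by rewrite -aa addrC addKr.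
have ZW : Z * W = W * Z.
  by rewrite WE mulrBr mulrBl mulr1 mul1r -scalerAl -scalerAr.
have ca : star c * star a = q *: (star a * star c).
  by rewrite -starM ac starZ starM conjCK.
have XE : star X = c * star a - q^* *: (star a * c).
  by rewrite starD starN starZ !starM starK.
(* The four terms of X X^* are computed separately. Each is a multiple of [Z * W], which equals
   [W * Z], and with the signs the coefficients t, -|q|^2, -|q|^2, t cancel. *)
have T1 : a * star c * (c * star a) = t *: (Z * W).
  rewrite -mulrA (mulrA (star c)) -/Z; transitivity (W - W * W).
    by rewrite ZE mulrBl mul1r mulrBr /W !mulrA.
  by rewrite -{1}[W]mul1r -mulrBl {1}WE opprB addrC subrK -scalerAl.
have T2 : a * star c * (star a * c) = q *: (W * Z).
  by rewrite -mulrA (mulrA (star c)) ca -scalerAl -scalerAr !mulrA.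
have T3 : star c * a * (c * star a) = q^* *: (Z * W).
  by rewrite -mulrA (mulrA a) ac -scalerAl -scalerAr !mulrA.
have T4 : star c * a * (star a * c) = Z * W.
  have ZZ : star c * (Z * c) = Z * Z by rewrite /Z -[in LHS]cc !mulrA.
  rewrite -mulrA (mulrA a) -/W WE mulrBl mul1r !mulrBr mulr1.
  by rewrite -scalerAl -!scalerAr ZZ.
have XX : star (star X) * star X = 0.
  rewrite starK XE mulrBl !mulrBr -!scalerAl -!scalerAr T1 T2 T3 T4 !scalerA.
  by rewrite [q^* * q]mulrC -tE ZW subrr.
have /eqP : cnorm (star X) ^+ 2 = 0.
  rewrite -cnorm_starM XX -(scale0r (0 : A)) cnormZ normr0 mul0r //.
rewrite expf_eq0 => /eqP/cnorm_eq0/(congr1 (@star _ A)).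
by rewrite starK star0 => /subr0_eq.
Qed.

Lemma suq2_castar : c * star a = q^* *: (star a * c).
Proof.
have := congr1 (@star _ A) suq2_acstar.
by rewrite starZ !starM starK.
Qed.

Lemma suq2_cstarastar : star c * star a = q *: (star a * star c).
Proof. by rewrite -starM (suq2_ac rel) starZ starM conjCK. Qed.
End QuantumSU2Relations.

(** * Twisted commutation of integer powers of unitaries *)

Section TwistedCommutation.
Variables (R : realType) (A : cstarAlgType R).
Implicit Types x y : A.

Lemma upow_twist (c : R[i]) x y n : Defs.is_unitary x -> c != 0 ->
  x * y = c *: (y * x) -> upow x n * y = c ^ n *: (y * upow x n).
Proof.
move=> [sx xs] c0 xy.
have twX (d : R[i]) z k : z * y = d *: (y * z) ->
    z ^+ k * y = d ^+ k *: (y * z ^+ k).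
  move=> zy; elim: k => [|k IHk]; first by rewrite !expr0 scale1r mul1r mulr1.
  by rewrite !exprS -mulrA IHk -scalerAr (mulrA z) zy -scalerAl scalerA mulrC mulrA.
case: n => k /=; first exact: twX.
(* A negative power of x is a power of its adjoint, the inverse of x, which passes y with the factor
   c^-1. *)
rewrite NegzE -exprz_inv -exprnP; apply: twX.
have yx : y * x = c^-1 *: (x * y) by rewrite xy scalerA mulVf // scale1r.
rewrite -[y in LHS]mulr1 -xs (mulrA y) yx -scalerAl -scalerAr.
by rewrite -(mulrA x) (mulrA (star x)) sx mul1r.
Qed.

(** Two uses of [upow_twist]: first for powers of x against y, then for powers of y against the
    fixed element x^m. *)
Lemma upow_twist2 (c : R[i]) x y m n :
  Defs.is_unitary x -> Defs.is_unitary y -> c != 0 ->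
  x * y = c *: (y * x) ->
  upow y n * upow x m = c ^ (- (n * m)) *: (upow x m * upow y n).
Proof.
move=> ux uy c0 xy; have cm : c ^ (- m) != 0 by rewrite expfz_neq0.
have yx : y * upow x m = c ^ (- m) *: (upow x m * y).
  by rewrite (upow_twist m ux c0 xy) scalerA -expfzDr // addNr expr0z scale1r.
by rewrite (upow_twist n uy cm yx) exprz_exp mulNr [m * n]mulrC.
Qed.

Lemma upow_linv x n : Defs.is_unitary x -> exists y, y * upow x n = 1.
Proof.
move=> [sx xs]; have invX (y z : A) k : y * z = 1 -> y ^+ k * z ^+ k = 1.
  move=> yz; elim: k => [|k IHk]; first by rewrite mulr1.
  by rewrite exprSr exprS -mulrA (mulrA y) yz mul1r.
by case: n => k; [exists (star x ^+ k)|exists (x ^+ k.+1)]; apply: invX.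
Qed.

Lemma upowM_neq0 x y m n : Defs.is_unitary x -> Defs.is_unitary y ->
  upow x m * upow y n != 0.
Proof.
move=> /(upow_linv m)[x' x'x] /(upow_linv n)[y' y'y]; apply/eqP => xy0.
have y0 : upow y n = 0 by rewrite -[LHS]mul1r -x'x -mulrA xy0 mulr0.
by move/esym/eqP: y'y; rewrite y0 mulr0 oner_eq0.
Qed.
End TwistedCommutation.

(** * The Hopf axioms on the four generators *)

Section BraidedSU2.
Variables (K : fieldType) (q p zeta : K).
Hypotheses (q0 : q != 0) (zeta0 : zeta != 0).
Variables (H : algType K) (comp : int -> set H) (act : int -> {linear H -> H}).
Hypothesis h : is_yd comp act.
Hypothesis actE : diag_act zeta comp act.
Hypothesis comp1 : comp 0 1.
Hypothesis compM : forall m n x y, comp m x -> comp n y -> comp (m + n) (x * y).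
Local Notation Y := (YDModule h).
Local Notation mu := (mul_map H).

Variables (Delta : {linear H -> tens H H}) (eps : {linear H -> K^o})
  (S : {linear H -> H}).
Hypothesis Delta_mul : forall x y,
  Delta (x * y) = bmul (B := Y) (C := Y) mu mu (Delta x \otimes Delta y).
Hypothesis Delta1 : Delta 1 = 1 \otimes 1.
Hypothesis epsM : forall x y, eps (x * y) = eps x * eps y.
Hypothesis eps1 : eps 1 = 1.
Hypothesis S1 : S 1 = 1.
Hypothesis S_comp : forall n x, comp n x -> comp n (S x).
Hypothesis SM : forall m n x y, comp m x -> comp n y ->
  S (x * y) = zeta ^ (- (m * n)) *: (S y * S x).

(* a, a', c, c' stand for alpha, alpha^*, gamma, gamma^*, and p for the
   conjugate of q. *)
Variables a a' c c' : H.
Hypothesis gen_ind : forall P : H -> Prop, P 1 ->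
  (forall k x y, P x -> P y -> P (k *: x + y)) ->
  (forall x y, x \in [:: a; a'; c; c'] -> P y -> P (x * y)) -> forall x, P x.
Hypotheses (a_comp : comp 0 a) (a'_comp : comp 0 a') (c_comp : comp 1 c)
  (c'_comp : comp (-1) c').
Hypotheses (rel_aa : a' * a + c' * c = 1)
  (rel_aa' : a * a' + (q * p) *: (c' * c) = 1)
  (rel_ac : a * c = p *: (c * a)) (rel_cc : c * c' = c' * c)
  (rel_ac' : a * c' = q *: (c' * a)) (rel_ca' : c * a' = p *: (a' * c))
  (rel_c'a' : c' * a' = q *: (a' * c')).
Hypotheses (Delta_a : Delta a = a \otimes a - q *: (c' \otimes c))
  (Delta_a' : Delta a' = a' \otimes a' - q *: (c \otimes c'))
  (Delta_c : Delta c = c \otimes a + a' \otimes c)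
  (Delta_c' : Delta c' = c' \otimes a' + a \otimes c').
Hypotheses (eps_a : eps a = 1) (eps_a' : eps a' = 1) (eps_c : eps c = 0)
  (eps_c' : eps c' = 0).
Hypotheses (S_a : S a = a') (S_a' : S a' = a) (S_c : S c = - (p *: c))
  (S_c' : S c' = - (q^-1 *: c')).

(** Six conditions remain, each for a, a', c, c' in turn: degrees, coassociativity, the two counit
    laws and the two antipode laws. *)
Lemma braided_su2_hopf :
  is_hopf_algebra (H := Y) mu (unit_map (1 : H)) Delta eps S.
Proof.
apply: (hopf_of_generators zeta0 actE comp1 compM Delta_mul Delta1 epsM eps1 S1
  S_comp SM gen_ind) => x; rewrite !inE => /or4P[]/eqP->.
- exists 0; split=> //; rewrite Delta_a addrC -scaleNr.
  apply: (tens_compP (V := Y) (W := Y)).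
    by rewrite -[0](addNr 1); apply: (tens_comp_mk (V := Y) (W := Y)).
  by rewrite -[0]addr0; apply: (tens_comp_mk (V := Y) (W := Y)).
- exists 0; split=> //; rewrite Delta_a' addrC -scaleNr.
  apply: (tens_compP (V := Y) (W := Y)).
    by rewrite -[0](subrr 1); apply: (tens_comp_mk (V := Y) (W := Y)).
  by rewrite -[0]addr0; apply: (tens_comp_mk (V := Y) (W := Y)).
- exists 1; split=> //; rewrite Delta_c -[c \otimes a]scale1r.
  apply: (tens_compP (V := Y) (W := Y)).
    by rewrite -[1]addr0; apply: (tens_comp_mk (V := Y) (W := Y)).
  by rewrite -[1]add0r; apply: (tens_comp_mk (V := Y) (W := Y)).
- exists (-1); split=> //; rewrite Delta_c' -[c' \otimes a']scale1r.
  apply: (tens_compP (V := Y) (W := Y)).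
    by rewrite -[-1]addr0; apply: (tens_comp_mk (V := Y) (W := Y)).
  by rewrite -[-1]add0r; apply: (tens_comp_mk (V := Y) (W := Y)).
(* [Delta] is the matrix comultiplication for the 2 by 2 matrix with rows a, -q c' and c, a'. Both
   sides therefore expand to the same four pure tensors, up to order. *)
- rewrite Delta_a !linearB /= !linearZ /= !tmapE /= Delta_a Delta_c Delta_c'.
  rewrite !(linearDl, linearBl, linearZl_LR, linearDr, linearBr, linearZr_LR) /=.
  rewrite !(linearD, linearB) /= !linearZ /= !tassocE !scalerA mulN1r mulrN1.
  by rewrite -!addrA; congr (_ + _); rewrite [RHS]addrC -addrA.
- rewrite Delta_a' !linearB /= !linearZ /= !tmapE /= Delta_a' Delta_c Delta_c'.
  rewrite !(linearDl, linearBl, linearZl_LR, linearDr, linearBr, linearZr_LR) /=.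
  rewrite !(linearD, linearB) /= !linearZ /= !tassocE !scalerA mulN1r mulrN1.
  by rewrite -!addrA; congr (_ + _); rewrite [RHS]addrC -addrA.
- rewrite Delta_c !linearD /= !tmapE /= Delta_c Delta_a Delta_a'.
  rewrite !(linearDl, linearBl, linearZl_LR, linearDr, linearBr, linearZr_LR) /=.
  rewrite !(linearD, linearB) /= !linearZ /= !tassocE !scalerA ?mulN1r ?mulrN1.
  by rewrite -!addrA; congr (_ + _); rewrite [RHS]addrC -addrA.
- rewrite Delta_c' !linearD /= !tmapE /= Delta_c' Delta_a Delta_a'.
  rewrite !(linearDl, linearBl, linearZl_LR, linearDr, linearBr, linearZr_LR) /=.
  rewrite !(linearD, linearB) /= !linearZ /= !tassocE !scalerA ?mulN1r ?mulrN1.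
  by rewrite -!addrA; congr (_ + _); rewrite [RHS]addrC -addrA.
- rewrite Delta_a !linearB /= !linearZ /= !tmapE /= !tlunitE eps_a eps_c'.
  by rewrite scale0r oppr0 scaler0 addr0 scale1r.
- rewrite Delta_a' !linearB /= !linearZ /= !tmapE /= !tlunitE eps_a' eps_c.
  by rewrite scale0r oppr0 scaler0 addr0 scale1r.
- rewrite Delta_c !linearD /= !tmapE /= !tlunitE eps_a' eps_c.
  by rewrite scale0r add0r scale1r.
- rewrite Delta_c' !linearD /= !tmapE /= !tlunitE eps_a eps_c'.
  by rewrite scale0r add0r scale1r.
- rewrite Delta_a !linearB /= !linearZ /= !tmapE /= !trunitE eps_a eps_c.
  by rewrite scale0r oppr0 scaler0 addr0 scale1r.
- rewrite Delta_a' !linearB /= !linearZ /= !tmapE /= !trunitE eps_a' eps_c'.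
  by rewrite scale0r oppr0 scaler0 addr0 scale1r.
- rewrite Delta_c !linearD /= !tmapE /= !trunitE eps_a eps_c.
  by rewrite scale0r addr0 scale1r.
- rewrite Delta_c' !linearD /= !tmapE /= !trunitE eps_a' eps_c'.
  by rewrite scale0r addr0 scale1r.
(* For a and a' the antipode laws become the two relations with right side 1; for c and c' they
   become the twisted commutations, the factors p and q^-1 in [S_c] and [S_c'] cancelling the
   twist. *)
- rewrite Delta_a !linearB /= !linearZ /= !tmapE !mul_mapE /= S_a S_c' eps_a.
  by rewrite mulNr opprK -scalerAl scalerA mulfV // !scale1r.
- rewrite Delta_a' !linearB /= !linearZ /= !tmapE !mul_mapE /= S_a' S_c eps_a'.
  by rewrite mulNr opprK -scalerAl scalerA rel_cc rel_aa' scale1r.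
- rewrite Delta_c !linearD /= !tmapE !mul_mapE /= S_c S_a' eps_c.
  by rewrite rel_ac mulNr -scalerAl addNr scale0r.
- rewrite Delta_c' !linearD /= !tmapE !mul_mapE /= S_c' S_a eps_c'.
  by rewrite mulNr -scalerAl rel_c'a' scalerA mulVf // scale1r addNr scale0r.
- rewrite Delta_a !linearB /= !linearZ /= !tmapE !mul_mapE /= S_a S_c eps_a.
  by rewrite mulrN opprK -scalerAr scalerA rel_aa' scale1r.
- rewrite Delta_a' !linearB /= !linearZ /= !tmapE !mul_mapE /= S_a' S_c' eps_a'.
  rewrite mulrN opprK -scalerAr scalerA mulfV // rel_cc.
  by rewrite !scale1r.
- rewrite Delta_c !linearD /= !tmapE !mul_mapE /= S_c S_a eps_c.
  by rewrite rel_ca' mulrN -scalerAr subrr scale0r.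
- rewrite Delta_c' !linearD /= !tmapE !mul_mapE /= S_c' S_a' eps_c'.
  by rewrite mulrN -scalerAr rel_ac' scalerA mulVf // scale1r subrr scale0r.
Qed.
End BraidedSU2.

(** * The grading of the polynomial algebra *)

Section PolynomialAlgebra.
Variables (R : realType) (A : cstarAlgType R) (alpha gamma : A).
Local Notation C := R[i].
Local Notation H := (polA alpha gamma).
Local Notation a := (pol_alpha alpha gamma).
Local Notation c := (pol_gamma alpha gamma).

Lemma pol_val_is_linear : linear (@pol_val R A alpha gamma).
Proof. by []. Qed.
HB.instance Definition _ :=
  GRing.isLinear.Build C H A *:%R (@pol_val R A alpha gamma) pol_val_is_linear.

Lemma pol_val_inj : injective (@pol_val R A alpha gamma).
Proof. exact: val_inj. Qed.

Lemma pol_ind (P : H -> Prop) : P 1 ->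
  (forall k x y, P x -> P y -> P (k *: x + y)) ->
  (forall x y, x \in [:: a; star a; c; star c] -> P y -> P (x * y)) ->
  forall x, P x.
Proof.
move=> P1 Plin PM; apply: star_subalg_ind => // x y Xx; apply: PM; rewrite !inE.
case: Xx => -[xE|xE]; apply/or4P.
- by apply: Or41; apply/eqP/pol_val_inj.
- by apply: Or43; apply/eqP/pol_val_inj.
- by apply: Or42; apply/eqP/pol_val_inj; rewrite -[LHS]starK; congr star.
- by apply: Or44; apply/eqP/pol_val_inj; rewrite -[LHS]starK; congr star.
Qed.

Variable rho : A -> C -> A.
Hypothesis hrho : is_circle_hom rho.
Hypothesis hrho_alpha : forall l : C, `|l| = 1 -> rho alpha l = alpha.
Hypothesis hrho_gamma : forall l : C, `|l| = 1 -> rho gamma l = l *: gamma.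
Local Notation comp := (pol_homog (alpha := alpha) (gamma := gamma) rho).

Lemma circle_neq0 (l : C) : `|l| = 1 -> l != 0.
Proof. by move=> l1; rewrite -normr_eq0 l1 oner_eq0. Qed.

Lemma homog1 : homog rho 0 1.
Proof. by move=> l l1; rewrite (starhom1 (circle_hom hrho l1)) expr0z scale1r. Qed.

Lemma homogM m n x y : homog rho m x -> homog rho n y -> homog rho (m + n) (x * y).
Proof.
move=> xm yn l l1; rewrite (starhomM (circle_hom hrho l1)) xm // yn //.
by rewrite -scalerAl -scalerAr scalerA -expfzDr // circle_neq0.
Qed.

(** On the unit circle the conjugate of l^n is l^(-n). *)
Lemma homog_star n x : homog rho n x -> homog rho (- n) (star x).
Proof.
move=> xn l l1; rewrite (starhom_star (circle_hom hrho l1)) xn // starZ.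
by rewrite fmorphXz /= -exprz_inv invC_norm l1 expr1n invr1 mul1r.
Qed.

Lemma homog_alpha : homog rho 0 alpha.
Proof. by move=> l l1; rewrite hrho_alpha // expr0z scale1r. Qed.

Lemma homog_gamma : homog rho 1 gamma.
Proof. by move=> l l1; rewrite hrho_gamma // expr1z. Qed.

Lemma pol_homog0 n : comp n 0.
Proof. by move=> l l1; rewrite (starhom0 (circle_hom hrho l1)) scaler0. Qed.

Lemma pol_homogP n k x y : comp n x -> comp n y -> comp n (k *: x + y).
Proof.
move=> xn yn l l1; rewrite linearP (starhom_linear (circle_hom hrho l1)).
by rewrite xn // yn // scalerDr !scalerA mulrC.
Qed.

Lemma pol_homog_gen x : x \in [:: a; star a; c; star c] -> exists d, comp d x.
Proof.
rewrite !inE => /or4P[]/eqP->.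
- by exists 0; apply: homog_alpha.
- by exists (- 0); apply: homog_star homog_alpha.
- by exists 1; apply: homog_gamma.
- by exists (-1); apply: homog_star homog_gamma.
Qed.

(** Words in the generators are homogeneous, which gives spanning. For independence, the circle
    action turns a vanishing sum into a relation between the characters l^n, valid at all points of
    the circle. *)
Lemma pol_grading : is_grading comp.
Proof.
apply: grading_of_span => [n|n k x y|x|s f us cf f0].
- exact: pol_homog0.
- exact: pol_homogP.
- elim/pol_ind: x => [|k _ _ [s [cs ->]] [t [ct ->]]|].
  + exists [:: (0, 1)]; rewrite big_seq1; split=> // p.
    by rewrite inE => /eqP ->; apply: homog1.
  + exists ([seq (p.1, k *: p.2) | p <- s] ++ t); split.
      move=> p; rewrite mem_cat => /orP[/mapP[r rs ->]|/ct//] /=.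
      by rewrite -[_ *: _]addr0; apply: pol_homogP; [apply: cs|apply: pol_homog0].
    by rewrite big_cat big_map scaler_sumr.
  + move=> x _ /pol_homog_gen[d xd] [s [cs ->]].
    exists [seq (d + p.1, x * p.2) | p <- s]; split.
      by move=> _ /mapP[r rs ->]; apply: homogM => //; apply: cs.
    by rewrite big_map mulr_sumr.
- move=> n ns; apply: pol_val_inj; rewrite linear0; move: n ns.
  apply: (circle_indep us) => l l1.
  have := congr1 (fun x => rho (pol_val x) l) f0.
  rewrite linear_sum (starhom_sum (circle_hom hrho l1)) linear0.
  rewrite (starhom0 (circle_hom hrho l1)) => f0l; rewrite -[RHS]f0l.
  by apply: eq_bigr => n _; rewrite (cf n).
Qed.
End PolynomialAlgebra.

(** * The braided tensor square inside the ambient C*-algebra *)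

Section BraidedTensorSquare.
Variables (R : realType) (zeta : R[i]).
Hypothesis zeta0 : zeta != 0.
Variables (A : cstarAlgType R) (alpha gamma : A) (rho : A -> R[i] -> A).
Local Notation H := (polA alpha gamma).
Local Notation comp := (pol_homog (alpha := alpha) (gamma := gamma) rho).
Variables (T : cstarAlgType R) (U V : T).
Hypothesis hUV : torus_rel zeta U V.
Variables (D : cstarAlgType R) (j0 : T -> D) (j1 j2 : A -> D).
Hypothesis hD : is_cstar_tensor3 j0 j1 j2.
Variables iota1 iota2 : A -> D.
Hypotheses (hiota1 : is_starhom iota1) (hiota2 : is_starhom iota2).
Hypothesis iota1_deg :
  forall n x, homog rho n x -> iota1 x = j0 (upow U n) * j1 x.
Hypothesis iota2_deg :
  forall n y, homog rho n y -> iota2 y = j0 (upow V n) * j2 y.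
Variable phi : {linear tens H H -> D}.
Hypothesis phiE : forall a b : H,
  phi (a \otimes b) = iota1 (pol_val a) * iota2 (pol_val b).
Variable act : int -> {linear H -> H}.
Hypothesis actE : diag_act zeta comp act.
Hypothesis h : is_yd comp act.
Local Notation Y := (YDModule h).

(** As the ranges of [j0] and [j1] commute, iota1 x iota2 y is j0 (U^m V^n) j1 x j2 y on bidegree
    (m, n), the shape required by [twisted_tens_inj]. *)
Lemma phi_inj : injective phi.
Proof.
have [J Jinj JE] := ct_alg hD; have [uU uV _] := hUV.
apply: (twisted_tens_inj (V := Y) (W := Y) (u := fun m n => upow U m * upow V n)
  Jinj (@pol_val_inj _ _ alpha gamma) (@pol_val_inj _ _ alpha gamma)).
  by move=> m n; apply: upowM_neq0.
move=> m n x y xm yn; rewrite JE phiE (iota1_deg xm) (iota2_deg yn).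
rewrite (starhomM (ct_hom0 hD)) -!mulrA; congr (_ * _).
by rewrite !mulrA (ct_comm01 hD).
Qed.

(** The ranges of [j0], [j1], [j2] commute with each other, so the only cost of the exchange is that
    of moving V^n past U^m. *)
Lemma iota_twist m n x y : homog rho m x -> homog rho n y ->
  iota2 y * iota1 x = zeta ^ (- (n * m)) *: (iota1 x * iota2 y).
Proof.
have [uU uV UV] := hUV; move=> xm yn.
rewrite (iota1_deg xm) (iota2_deg yn).
have -> : j0 (upow V n) * j2 y * (j0 (upow U m) * j1 x) =
    j0 (upow V n * upow U m) * (j1 x * j2 y).
  rewrite (starhomM (ct_hom0 hD)) -!mulrA; congr (_ * _).
  by rewrite (ct_comm12 hD) !mulrA (ct_comm02 hD).
rewrite (upow_twist2 m n uU uV zeta0 UV) (starhomZ (ct_hom0 hD)) -scalerAl.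
congr (_ *: _); rewrite (starhomM (ct_hom0 hD)) -!mulrA; congr (_ * _).
by rewrite !mulrA (ct_comm01 hD).
Qed.

(** The scalar by which the degree of y acts on x' in the braided product is exactly the one
    produced when iota2 y moves past iota1 x'. *)
Lemma phi_bmul z w :
  phi (bmul (B := Y) (C := Y) (mul_map H) (mul_map H) (z \otimes w)) = phi z * phi w.
Proof.
elim/(@tens_homog_ind _ Y Y): z => [_ n x y _ yn|z z' IHz IHz']; last first.
  by rewrite linearDl !linearD IHz IHz' mulrDl.
elim/(@tens_homog_ind _ Y Y): w => [m _ x' y' xm _|w w' IHw IHw']; last first.
  by rewrite linearDr !linearD IHw IHw' mulrDr.
rewrite (bmulE (B := Y) (C := Y) _ _ _ _ _ yn) !mul_mapE /= (actE _ xm) !phiE.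
have -> : pol_val (x * (zeta ^ (- (n * m)) *: x')) =
  zeta ^ (- (n * m)) *: (pol_val x * pol_val x') by rewrite -scalerAr linearZ.
rewrite (starhomZ hiota1) !(starhomM hiota1) !(starhomM hiota2) -!mulrA.
by rewrite (mulrA (iota2 _)) (iota_twist xm yn) -!scalerAl -!scalerAr !mulrA.
Qed.
End BraidedTensorSquare.

Unset Implicit Arguments.

(** * The braided Hopf algebra of the quantum SU(2) group *)

Theorem proposition3p32 (R : realType) (q : R[i])
  (hq0 : 0 < `|q|) (hq1 : `|q| < 1)
  (zeta : R[i]) (hzeta : zeta = q / q^*)
  (* the C*-algebra A, its circle action and its degrees *)
  (A : cstarAlgType R) (alpha gamma : A)
  (hA : is_universal2 (suq2_rel q) alpha gamma)
  (rho : A -> R[i] -> A) (hrho : is_circle_hom rho)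
  (hrho_alpha : forall l : R[i], `|l| = 1 -> rho alpha l = alpha)
  (hrho_gamma : forall l : R[i], `|l| = 1 -> rho gamma l = l *: gamma)
  (* the ambient C*-algebra C(T^2_zeta) (x) A (x) A *)
  (T : cstarAlgType R) (U V : T)
  (hT : is_universal2 (torus_rel zeta) U V)
  (D : cstarAlgType R) (j0 : T -> D) (j1 j2 : A -> D)
  (hD : is_cstar_tensor3 j0 j1 j2)
  (iota1 iota2 : A -> D)
  (hiota1 : is_starhom iota1) (hiota2 : is_starhom iota2)
  (hiota1_deg : forall n x, homog rho n x -> iota1 x = j0 (upow U n) * j1 x)
  (hiota2_deg : forall n y, homog rho n y -> iota2 y = j0 (upow V n) * j2 y)
  (* the comultiplication Delta_A : A -> A [x] A *)
  (DeltaA : A -> D) (hDeltaA : is_starhom DeltaA)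
  (hDeltaA_im : forall x, boxtimes iota1 iota2 (DeltaA x))
  (hDeltaA_alpha : DeltaA alpha =
     iota1 alpha * iota2 alpha - q *: (iota1 (star gamma) * iota2 gamma))
  (hDeltaA_gamma : DeltaA gamma =
     iota1 gamma * iota2 alpha + iota1 (star alpha) * iota2 gamma)
  (* the structure maps on the polynomial algebra *)
  (phi : {linear tens (polA alpha gamma) (polA alpha gamma) -> D})
  (hphi : forall a b : polA alpha gamma,
     phi (a \otimes b) = iota1 (pol_val a) * iota2 (pol_val b))
  (Delta : {linear polA alpha gamma -> tens (polA alpha gamma) (polA alpha gamma)})
  (hDelta : forall a : polA alpha gamma, phi (Delta a) = DeltaA (pol_val a))
  (epsA : A -> R[i]^o) (hepsA : is_starhom epsA)
  (hepsA_alpha : epsA alpha = 1) (hepsA_gamma : epsA gamma = 0)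
  (eps : {linear polA alpha gamma -> R[i]^o})
  (heps : forall a : polA alpha gamma, eps a = epsA (pol_val a))
  (S : {linear polA alpha gamma -> polA alpha gamma})
  (hS1 : S 1 = 1)
  (hS_deg : forall n a, pol_homog rho n a -> pol_homog rho n (S a))
  (hS_alpha : S (pol_alpha alpha gamma) = star (pol_alpha alpha gamma))
  (hS_alpha' : S (star (pol_alpha alpha gamma)) = pol_alpha alpha gamma)
  (hS_gamma : S (pol_gamma alpha gamma) = - (q^* *: pol_gamma alpha gamma))
  (hS_gamma' : S (star (pol_gamma alpha gamma)) = - (q^-1 *: star (pol_gamma alpha gamma)))
  (hSM : forall m n (a b : polA alpha gamma), pol_homog rho m a -> pol_homog rho n b ->
     S (a * b) = zeta ^ (- (m * n)) *: (S b * S a))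
  (* the action of the integers *)
  (act : int -> {linear polA alpha gamma -> polA alpha gamma})
  (hact : forall k n (a : polA alpha gamma), pol_homog rho n a ->
     act k a = zeta ^ (- (k * n)) *: a) :
  exists h : is_yd (pol_homog (alpha := alpha) (gamma := gamma) rho) act,
    is_hopf_algebra (H := YDModule h) (mul_map (polA alpha gamma))
      (unit_map (1 : polA alpha gamma)) Delta eps S.
Proof.
set H := polA alpha gamma; pose a := pol_alpha alpha gamma.
pose c := pol_gamma alpha gamma.
have q0 : q != 0 by rewrite -normr_gt0.
have zeta0 : zeta != 0 by rewrite hzeta mulf_neq0 // invr_eq0 conjC_eq0.
have qzeta : q^* * zeta = q by rewrite hzeta mulrCA mulfV ?mulr1 // conjC_eq0.
have rel := universal2_rel hA.
have hUV := universal2_rel hT.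
have h := diag_is_yd zeta0 (pol_grading hrho hrho_alpha hrho_gamma) hact.
exists h.
have phiI := phi_inj hUV hD hiota1_deg hiota2_deg hphi h.
have alpha_homog := homog_alpha hrho_alpha.
have gamma_homog := homog_gamma hrho_gamma.
have alphas_homog := homog_star hrho alpha_homog.
have gammas_homog := homog_star hrho gamma_homog.
have twist m n x y := @iota_twist R zeta zeta0 A rho T U V hUV D j0 j1 j2 hD
  iota1 iota2 hiota1_deg hiota2_deg m n x y.
have phiD (x y x' y' : H) : phi (x \otimes y + x' \otimes y') =
    iota1 (pol_val x) * iota2 (pol_val y) +
    iota1 (pol_val x') * iota2 (pol_val y').
  by rewrite linearD /= !hphi.
have phiB (x y x' y' : H) k : phi (x \otimes y - k *: (x' \otimes y')) =
    iota1 (pol_val x) * iota2 (pol_val y) -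
    k *: (iota1 (pol_val x') * iota2 (pol_val y')).
  by rewrite -scaleNr linearD linearZ /= !hphi scaleNr.
have Delta_a : Delta a = a \otimes a - q *: (star c \otimes c).
  by apply: phiI; rewrite hDelta hDeltaA_alpha phiB.
have Delta_c : Delta c = c \otimes a + star a \otimes c.
  by apply: phiI; rewrite hDelta hDeltaA_gamma phiD.
(* The adjoint reverses the products, and [twist] restores their order. In the second term the
   degrees 1 and -1 produce [zeta], and [qzeta] merges it with the conjugated coefficient into q. *)
have Delta_a' : Delta (star a) = star a \otimes star a - q *: (c \otimes star c).
  apply: phiI; rewrite hDelta (starhom_star hDeltaA) hDeltaA_alpha phiB.
  rewrite starD starN starZ !starM -!(starhom_star hiota1) -!(starhom_star hiota2).
  rewrite starK (twist _ _ _ _ alphas_homog alphas_homog).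
  rewrite (twist _ _ _ _ gamma_homog gammas_homog) expr0z expr1z scale1r.
  by rewrite scalerA qzeta.
(* In each reordered product one factor has degree 0, so no scalar appears. *)
have Delta_c' : Delta (star c) = star c \otimes star a + a \otimes star c.
  apply: phiI; rewrite hDelta (starhom_star hDeltaA) hDeltaA_gamma phiD.
  rewrite starD !starM.
  rewrite -!(starhom_star hiota1) -!(starhom_star hiota2) starK.
  rewrite (twist _ _ _ _ gammas_homog alphas_homog).
  by rewrite (twist _ _ _ _ alpha_homog gammas_homog) !expr0z !scale1r.
have Delta1 : Delta 1 = 1 \otimes 1.
  apply: phiI; rewrite hDelta hphi (starhom1 hDeltaA) (starhom1 hiota1).
  by rewrite (starhom1 hiota2) mulr1.
have epsM (x y : H) : eps (x * y) = eps x * eps y.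
  by rewrite !heps; apply: (starhomM hepsA).
have eps_star (x : H) : eps (star x) = (eps x : R[i])^*.
  by rewrite !heps; apply: (starhom_star hepsA).
have eps_a : eps a = 1 by rewrite heps hepsA_alpha.
have eps_c : eps c = 0 by rewrite heps hepsA_gamma.
(* Multiplicativity of [DeltaA] is pulled back along the injective [phi], which turns the braided
   product into that of [D]. *)
have Delta_mul (x y : H) : Delta (x * y) = bmul (B := YDModule h)
    (C := YDModule h) (mul_map H) (mul_map H) (Delta x \otimes Delta y).
  apply: phiI; rewrite hDelta.
  rewrite (phi_bmul zeta0 hUV hD hiota1 hiota2 hiota1_deg hiota2_deg hphi hact).
  by rewrite !hDelta; apply: (starhomM hDeltaA).
have compM := @homogM R A rho hrho.
have eps1 : eps 1 = 1 by rewrite heps; apply: (starhom1 hepsA).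
have eps_a' : eps (star a) = 1 by rewrite eps_star eps_a rmorph1.
have eps_c' : eps (star c) = 0 by rewrite eps_star eps_c rmorph0.
refine (@braided_su2_hopf _ q q^* zeta q0 zeta0 H _ act h hact
  (homog1 hrho) (fun m n x y => compM m n (pol_val x) (pol_val y))
  Delta eps S Delta_mul Delta1 epsM eps1 hS1 hS_deg hSM
  a (star a) c (star c) (@pol_ind _ _ _ _) alpha_homog alphas_homog gamma_homog
  gammas_homog _ _ _ _ _ _ _ Delta_a Delta_a' Delta_c Delta_c' eps_a eps_a' eps_c
  eps_c' hS_alpha hS_alpha' hS_gamma hS_gamma').
- by apply: pol_val_inj; apply: (suq2_aa rel).
- by apply: pol_val_inj; rewrite -normCK; apply: (suq2_aa' rel).
- by apply: pol_val_inj; apply: (suq2_ac rel).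
- by apply: pol_val_inj; apply: (suq2_cc rel).
- by apply: pol_val_inj; apply: (suq2_acstar rel).
- by apply: pol_val_inj; apply: (suq2_castar rel).
- by apply: pol_val_inj; apply: (suq2_cstarastar rel).
Qed.
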